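(* Let $\theta$ be a non-constant inner function and let $a\in L^\infty(\mathbb{T})$. For a bounded linear operator $X$ on $L^2(\mathbb{T})$, the following are equivalent: (1) there exists $\beta\in L^\infty(\mathbb{T})$ such that $X=M_\beta+M_aP_{\mathcal{K}_\theta}$; (2) $[X,M_z]=a\otimes\bar z-a\theta\otimes\bar z\theta$. Consequently, there exist $\varphi,\psi\in L^\infty(\mathbb{T})$ with $\varphi-\psi=a$ and $X=M_\varphi P_{\mathcal{K}_\theta}+M_\psi(I-P_{\mathcal{K}_\theta})$ if and only if the commutator identity $[X,M_z]=a\otimes\bar z-a\theta\otimes\bar z\theta$ holds.
   Context: $\mathbb{T}$ is the unit circle with normalized Lebesgue measure; $H^2\subset L^2(\mathbb{T})$ is the Hardy space (functions with vanishing negative Fourier coefficients). An inner function $\theta$ is a bounded analytic function on the unit disk with $|\theta|=1$ a.e. on $\mathbb{T}$. The model space is $\mathcal{K}_\theta=H^2\ominus\theta H^2$ and $P_{\mathcal{K}_\theta}$ is the orthogonal projection of $L^2(\mathbb{T})$ onto $\mathcal{K}_\theta$, viewed as an operator on $L^2(\mathbb{T})$. For $\varphi\in L^\infty(\mathbb{T})$, $M_\varphi f=\varphi f$ on $L^2(\mathbb{T})$; $M_z$ is the bilateral shift (multiplication by the coordinate function $z$). $[A,B]=AB-BA$. For vectors $p,q$ in a Hilbert space, $(p\otimes q)f=\langle f,q\rangle p$ (inner product linear in the first variable). *)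

(* Defs.v *)
From HB Require Import structures.
From mathcomp Require Import all_boot all_order all_algebra.
From mathcomp Require Import all_classical all_reals all_analysis.
From mathcomp Require Import ess_sup_inf measurable_realfun.
From mathcomp Require Import generic_quotient ring_quotient complex.

Set Implicit Arguments.
Unset Strict Implicit.
Unset Printing Implicit Defensive.

Import Order.TTheory GRing.Theory Num.Theory.
Import numFieldNormedType.Exports.
Import ComplexField.Normc.

Local Open Scope classical_set_scope.
Local Open Scope ring_scope.

Local Notation Re := complex.Re.
Local Notation Im := complex.Im.

Section finite_norm_extra.
Context d (T : measurableType d) (R : realType).
Variables (mu : {measure set T -> \bar R}) (p : \bar R).

Lemma finite_norm_ae_le (f g : T -> R) : (1 <= p)%E ->
  measurable_fun setT f -> measurable_fun setT g ->
  (\forall x \ae mu, `|f x| <= `|g x|) ->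
  finite_norm mu p g -> finite_norm mu p f.
Proof.
rewrite /finite_norm unlock /Lnorm; case: p => // [r|] p1 mf mg fg.
- apply: le_lt_trans.
  have r0 : 0 <= r by rewrite (le_trans ler01)// -lee_fin.
  have r1 : 0 <= r^-1 by rewrite invr_ge0.
  have i0 (h : T -> R) : (0 <= \int[mu]_x (`|(EFin \o h) x| `^ r))%E.
    by apply: integral_ge0 => x _; exact: poweR_ge0.
  apply: gt0_ler_poweR => //.
  + by rewrite in_itv /= leey andbT; exact: i0.
  + by rewrite in_itv /= leey andbT; exact: i0.
  apply: ae_ge0_le_integral => //.
  + by move=> x _; exact: poweR_ge0.
  + apply/measurable_EFinP; apply: (measurableT_comp (measurable_powR r)).
    exact: measurableT_comp.
  + by move=> x _; exact: poweR_ge0.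
  + apply/measurable_EFinP; apply: (measurableT_comp (measurable_powR r)).
    exact: measurableT_comp.
  + by apply: filterS fg => x fgx _; rewrite /= lee_fin ge0_ler_powR.
- case: ifPn => // _; apply: le_lt_trans; apply: le_ess_sup.
  by apply: filterS fg => x fgx /=; rewrite lee_fin.
Qed.

End finite_norm_extra.

Lemma normc_ge0 (R : rcfType) (x : R[i]) : 0 <= normc x.
Proof. by case: x => a b; exact: sqrtr_ge0. Qed.

Section complex_measurable.
Context d (T : measurableType d) (R : realType).

Definition cmeasurable (f : T -> R[i]) :=
  measurable_fun setT (@Re R \o f) /\ measurable_fun setT (@Im R \o f).

Lemma cmeasurable_normc f : cmeasurable f -> measurable_fun setT (@normc R \o f).
Proof.
move=> [mr mi].
rewrite (_ : _ \o _ =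
  (@Num.sqrt R) \o ((fun x => Re (f x) ^+ 2) \+ (fun x => Im (f x) ^+ 2))).
  apply: measurableT_comp.
    by apply: continuous_measurable_fun; exact: sqrt_continuous.
  by apply: measurable_funD; exact: measurable_funX.
by apply/funext => x /=; case: (f x).
Qed.

Lemma cmeasurableD f g :
  cmeasurable f -> cmeasurable g -> cmeasurable (f \+ g).
Proof.
move=> [fr fi] [gr gi]; split.
  rewrite (_ : _ \o _ = (@Re R \o f) \+ (@Re R \o g)); first exact: measurable_funD.
  by apply/funext => x /=; case: (f x) (g x) => ? ? [].
rewrite (_ : _ \o _ = (@Im R \o f) \+ (@Im R \o g)); first exact: measurable_funD.
by apply/funext => x /=; case: (f x) (g x) => ? ? [].
Qed.

Lemma cmeasurableM f g :
  cmeasurable f -> cmeasurable g -> cmeasurable (f \* g).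
Proof.
move=> [fr fi] [gr gi]; split.
  rewrite (_ : _ \o _ = ((@Re R \o f) \* (@Re R \o g)) \- ((@Im R \o f) \* (@Im R \o g))).
    by apply: measurable_funB; exact: measurable_funM.
  by apply/funext => x /=; case: (f x) (g x) => ? ? [].
rewrite (_ : _ \o _ = ((@Re R \o f) \* (@Im R \o g)) \+ ((@Im R \o f) \* (@Re R \o g))).
  by apply: measurable_funD; exact: measurable_funM.
by apply/funext => x /=; case: (f x) (g x) => ? ? [].
Qed.

Lemma cmeasurable_cst (c : R[i]) : cmeasurable (cst c).
Proof. by split; exact: measurable_cst. Qed.

Lemma cmeasurable_conj f : cmeasurable f -> cmeasurable (@conjc R \o f).
Proof.
move=> [fr fi]; split.
  rewrite (_ : _ \o _ = @Re R \o f)//.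
  by apply/funext => x /=; case: (f x).
rewrite (_ : _ \o _ = \- (@Im R \o f)); first exact: measurableT_comp.
by apply/funext => x /=; case: (f x).
Qed.

End complex_measurable.

Section complex_Lfun.
Context d (T : measurableType d) (R : realType).
Variables (mu : {measure set T -> \bar R}) (p : \bar R).

Definition cLfun_pred : {pred T -> R[i]} :=
  mem [set f | cmeasurable f /\ finite_norm mu p (@normc R \o f)].

Lemma cLfun_predP f :
  f \in cLfun_pred <-> cmeasurable f /\ finite_norm mu p (@normc R \o f).
Proof. by rewrite inE. Qed.

Hypothesis p1 : (1 <= p)%E.

Lemma normc_Lfun f : f \in cLfun_pred -> @normc R \o f \in Lfun mu p.
Proof.
move=> /cLfun_predP[mf ff]; rewrite inE; apply/andP; split; rewrite inE//.
exact: cmeasurable_normc.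
Qed.

Lemma cLfun_le (f : T -> R[i]) (g : T -> R) : cmeasurable f -> g \in Lfun mu p ->
  (\forall x \ae mu, normc (f x) <= `|g x|) -> f \in cLfun_pred.
Proof.
move=> mf /andP[/set_mem mg /set_mem fg] le; apply/cLfun_predP; split => //.
apply: (finite_norm_ae_le p1 _ mg _ fg); first exact: cmeasurable_normc.
by apply: filterS le => x h; rewrite /= [X in X <= _]ger0_norm ?normc_ge0.
Qed.

End complex_Lfun.

Section complex_Lp.
Context d (T : measurableType d) (R : realType).
Variables (mu : {measure set T -> \bar R}) (p : \bar R) (p1 : (1 <= p)%E).

Lemma cLfun_submod_closed : submod_closed (cLfun_pred mu p).
Proof.
split=> [|a f g fp gp].
  apply: (@cLfun_le _ _ _ mu p p1 _ (cst 0)); first exact: cmeasurable_cst.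
    by rewrite -[cst 0]/(0 : T -> R) rpred0.
  by apply: aeW => x /=; rewrite normr0 [X in X <= _]normc0.
apply: (@cLfun_le _ _ _ mu p p1 _
  (normc a *: (@normc R \o f : T -> R) + (@normc R \o g))).
- move: fp gp => /cLfun_predP[mf _] /cLfun_predP[mg _].
  by apply: cmeasurableD => //; apply: cmeasurableM => //; exact: cmeasurable_cst.
- by rewrite rpredD ?rpredZ ?normc_Lfun.
- apply: aeW => x /=.
  rewrite (le_trans _ (ler_norm _))// (le_trans (le_normcD _ _))//.
  by rewrite lerD2r normcM.
Qed.

End complex_Lp.

Section complex_Lfun_type.
Context d (T : measurableType d) (R : realType).
Variables (mu : {measure set T -> \bar R}) (p : \bar R).

Record cLfun (p1 : (1 <= p)%E) : Type := CLfun {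
  cLfun_fun :> T -> R[i];
  cLfunP : cLfun_fun \in cLfun_pred mu p
}.

End complex_Lfun_type.

Section complex_Lspace.
Context d (T : measurableType d) (R : realType).
Variables (mu : {measure set T -> \bar R}) (p : \bar R) (p1 : (1 <= p)%E).
Local Notation L := (cLfun mu p1).

HB.instance Definition _ := [isSub for @cLfun_fun d T R mu p p1].
HB.instance Definition _ := [Choice of L by <:].
HB.instance Definition _ := GRing.isSubmodClosed.Build _ _ (cLfun_pred mu p)
  (cLfun_submod_closed mu p1).
HB.instance Definition _ := [SubChoice_isSubLmodule of L by <:].

Definition cLfun_null : {pred L} := mem [set f : L | (f : T -> R[i]) = cst 0 %[ae mu]].

Lemma cLfun_null_submod_closed : submod_closed cLfun_null.
Proof.
split=> [|a f g]; first by apply/mem_set; apply: aeW.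
move=> /set_mem f0 /set_mem g0; apply/mem_set => /=.
apply: filterS2 f0 g0 => x fx gx _.
by rewrite -[LHS]/(a * f x + g x) (fx Logic.I) (gx Logic.I) mulr0 addr0.
Qed.

HB.instance Definition _ := GRing.isSubmodClosed.Build _ _ cLfun_null
  cLfun_null_submod_closed.

Definition cLp : Type := Quotient.quot cLfun_null.
HB.instance Definition _ := GRing.Zmodule.on cLp.
HB.instance Definition _ := EqQuotient.on cLp.

Local Open Scope quotient_scope.

Lemma cLp_eqP (f g : L) :
  \pi_cLp f = \pi_cLp g <-> (f : T -> R[i]) = g %[ae mu].
Proof.
split=> [/eqP|fg].
  rewrite -Quotient.idealrBE => /set_mem.
  by apply: filterS => x + _ => /(_ Logic.I) /eqP; rewrite /= subr_eq0 => /eqP.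
apply/eqP; rewrite -Quotient.idealrBE; apply/mem_set.
by apply: filterS fg => x fgx _; rewrite -[LHS]/(f x - g x) (fgx Logic.I) subrr.
Qed.

Definition cLp_scale (a : R[i]) (f : cLp) : cLp := \pi_cLp (a *: repr f).

Lemma cLp_pi_scale a (f : L) : cLp_scale a (\pi_cLp f) = \pi_cLp (a *: f).
Proof.
apply/cLp_eqP; have /cLp_eqP := reprK (\pi_cLp f).
by apply: filterS => x fx _; congr (a * _); exact: fx.
Qed.

Lemma cLp_piD (f g : L) : \pi_cLp (f + g) = \pi_cLp f + \pi_cLp g.
Proof. exact: pi_addr. Qed.

Lemma cLp_scaleA a b f : cLp_scale a (cLp_scale b f) = cLp_scale (a * b) f.
Proof. by elim/quotW: f => f; rewrite (cLp_pi_scale b) !cLp_pi_scale scalerA. Qed.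

Lemma cLp_scale1 : left_id 1 cLp_scale.
Proof. by elim/quotW => f; rewrite cLp_pi_scale scale1r. Qed.

Lemma cLp_scaleDr : right_distributive cLp_scale +%R.
Proof.
move=> a; elim/quotW => f; elim/quotW => g.
by rewrite -cLp_piD !cLp_pi_scale -cLp_piD scalerDr.
Qed.

Lemma cLp_scaleDl f : {morph cLp_scale^~ f : a b / a + b}.
Proof. by move=> a b; elim/quotW: f => f; rewrite !cLp_pi_scale -cLp_piD scalerDl. Qed.

HB.instance Definition _ := GRing.Zmodule_isLmodule.Build R[i] cLp
  cLp_scaleA cLp_scale1 cLp_scaleDr cLp_scaleDl.

Definition cLp_norm (f : cLp) : R :=
  fine ('N[mu]_p[EFin \o (@normc R \o repr f)])%E.

End complex_Lspace.
Arguments cLp {d T R} mu {p} p1.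

Section complex_Lp_mul.
Context d (T : measurableType d) (R : realType).
Variables (mu : {measure set T -> \bar R}) (p : \bar R) (p1 : (1 <= p)%E).
Local Notation Loo := (cLfun mu (leey 1%E)).
Local Notation L := (cLfun mu p1).
Local Open Scope quotient_scope.

Lemma cLfun_mul_subproof (f : Loo) (g : L) :
  (f : T -> R[i]) \* g \in cLfun_pred mu p.
Proof.
have := cLfunP f; have := cLfunP g.
move=> gp /cLfun_predP[mf ff]; have /cLfun_predP[mg _] := gp.
have [M fM] : exists M : R, \forall x \ae mu, normc (f x) <= M.
  move: ff; rewrite /finite_norm unlock /Lnorm; case: ifPn => [_|mu0 _].
    set e := ess_sup _ _ => ey.
    exists (fine e).
    have := ess_sup_ge mu (abse \o (EFin \o (@normc R \o f))).
    apply: filterS => x; rewrite -/e /=; move: ey; case: e => //= r _.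
    by rewrite lee_fin; apply: le_trans; exact: ler_norm.
  exists 0; exists setT; split => //.
  by apply/eqP; rewrite eq_le measure_ge0 andbT leNgt.
apply: (@cLfun_le _ _ _ mu p p1 _ (M *: (@normc R \o g : T -> R))).
- exact: cmeasurableM.
- by rewrite rpredZ// normc_Lfun.
- apply: filterS fM => x fxM /=; rewrite normcM (le_trans _ (ler_norm _))//.
  by apply: ler_wpM2r => //; exact: normc_ge0.
Qed.

Definition cLfun_mul (f : Loo) (g : L) : L :=
  CLfun p1 (cLfun_mul_subproof f g).

Definition cLp_mul (f : cLp mu (leey 1%E)) (g : cLp mu p1) : cLp mu p1 :=
  \pi_(cLp mu p1) (cLfun_mul (repr f) (repr g)).

Lemma cLp_mulE (f : Loo) (g : L) :
  cLp_mul (\pi_(cLp mu (leey 1%E)) f) (\pi_(cLp mu p1) g) =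
  \pi_(cLp mu p1) (cLfun_mul f g).
Proof.
apply/cLp_eqP.
have /cLp_eqP f_ := reprK (\pi_(cLp mu (leey 1%E)) f).
have /cLp_eqP g_ := reprK (\pi_(cLp mu p1) g).
by apply: filterS2 f_ g_ => x fx gx _ /=; rewrite fx// gx.
Qed.

End complex_Lp_mul.

Section complex_Lp_incl.
Context d (T : measurableType d) (R : realType).
Variables (mu : {finite_measure set T -> \bar R}) (p : \bar R) (p1 : (1 <= p)%E).
Local Notation Loo := (cLfun mu (leey 1%E)).
Local Notation L := (cLfun mu p1).
Local Open Scope quotient_scope.

Lemma cLfun_incl_subproof (f : Loo) : (f : T -> R[i]) \in cLfun_pred mu p.
Proof.
have fp := cLfunP f; have /cLfun_predP[mf _] := fp.
apply: (@cLfun_le _ _ _ mu p p1 _ (@normc R \o f)) => //.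
  apply: (@Lfun_subset _ _ _ mu p +oo%E p1 (leey _)); rewrite ?leey//.
    exact: fin_num_measure.
  exact: normc_Lfun.
by apply: aeW => x; exact: ler_norm.
Qed.

Definition cLfun_incl (f : Loo) : L := CLfun p1 (cLfun_incl_subproof f).

Definition cLp_incl (f : cLp mu (leey 1%E)) : cLp mu p1 :=
  \pi_(cLp mu p1) (cLfun_incl (repr f)).

Lemma cLp_inclE (f : Loo) :
  cLp_incl (\pi_(cLp mu (leey 1%E)) f) = \pi_(cLp mu p1) (cLfun_incl f).
Proof.
apply/cLp_eqP; have /cLp_eqP := reprK (\pi_(cLp mu (leey 1%E)) f).
by apply: filterS => x fx _; exact: fx.
Qed.

End complex_Lp_incl.

Definition circle_display : measure_display.
Proof. exact. Qed.

Section circle.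
Context (R : realType).

Record circle : Type := Circle {
  circle_val :> R[i];
  circleP : normc circle_val == 1
}.

HB.instance Definition _ := [isSub for circle_val].
HB.instance Definition _ := [Choice of circle by <:].

Definition circle1 : circle := @Circle 1 (introT eqP (normc1 R)).
HB.instance Definition _ := isPointed.Build circle circle1.

Definition circle_coord (z : circle) : measurableTypeR R * measurableTypeR R :=
  (Re z, Im z).

(* The Borel sigma-algebra of the circle, seen as a subspace of the plane. *)
Definition circle_measurable : set (set circle) :=
  g_sigma_algebra_preimage circle_coord.

Let circle_measurable0 : circle_measurable set0.
Proof. exact: (@measurable0 _ (g_sigma_algebra_preimageType circle_coord)). Qed.

Let circle_measurableC A : circle_measurable A -> circle_measurable (~` A).
Proof. exact: (@measurableC _ (g_sigma_algebra_preimageType circle_coord)). Qed.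

Let circle_bigcup_measurable (F : (set circle)^nat) :
  (forall i, circle_measurable (F i)) -> circle_measurable (\bigcup_i F i).
Proof.
move=> mF.
exact: (@bigcupT_measurable _ (g_sigma_algebra_preimageType circle_coord)).
Qed.

HB.instance Definition _ := @isMeasurable.Build circle_display circle
  circle_measurable circle_measurable0 circle_measurableC
  circle_bigcup_measurable.

Lemma expi_subproof (t : R) : normc (cos t +i* sin t)%C == 1.
Proof. by rewrite /= cos2Dsin2 sqrtr1. Qed.

Definition expi (t : R) : circle := Circle (expi_subproof t).

Lemma measurable_expi : measurable_fun setT (expi : measurableTypeR R -> circle).
Proof.
move=> _ _ [B mB <-]; rewrite setTI setTI.
rewrite (_ : _ @^-1` _ =
  (fun t : R => (cos t, sin t) : measurableTypeR R * measurableTypeR R) @^-1` B)//.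
rewrite -[X in measurable X]setTI.
apply: (@measurable_fun_pair _ _ _ _ _ _ (@cos R) (@sin R)) => //.
  by apply: continuous_measurable_fun; exact: continuous_cos.
by apply: continuous_measurable_fun; exact: continuous_sin.
Qed.

HB.instance Definition _ := isMeasurableFun.Build _ _ _ _
  (expi : measurableTypeR R -> circle) measurable_expi.

Lemma twopi_gt0 : 0 < 2 * trigo.pi :> R.
Proof. by rewrite mulr_gt0// pi_gt0. Qed.

Definition circle_measure : set circle -> \bar R :=
  distribution (uniform_prob twopi_gt0) expi.

HB.instance Definition _ := Probability.copy circle_measure
  (distribution (uniform_prob twopi_gt0) expi).

End circle.
Arguments circle_measure R : clear implicits.

Notation L2 R := (cLp (circle_measure R) (lee1n 2)).
Notation Linf R := (cLp (circle_measure R) (leey 1%E)).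

Section Hardy.
Context (R : realType).
Local Open Scope quotient_scope.
Local Notation C := R[i].
Local Notation L2 := (L2 R).
Local Notation Linf := (Linf R).
Local Notation m := (circle_measure R).

Definition cintegral (f : circle R -> C) : C :=
  Complex (\int[m]_z Re (f z)) (\int[m]_z Im (f z)).

Definition inner (f g : L2) : C := cintegral (fun z => repr f z * conjc (repr g z)).

Lemma cmeasurable_circle_val : cmeasurable (@circle_val R).
Proof.
split=> _ B mB; rewrite setTI.
  exists (fst @^-1` B); last by rewrite setTI.
  by rewrite -[X in measurable X]setTI; exact: measurable_fst.
exists (snd @^-1` B); last by rewrite setTI.
by rewrite -[X in measurable X]setTI; exact: measurable_snd.
Qed.

Lemma circle_exp_subproof (n : int) :
  (fun z : circle R => (z : C) ^ n) \in cLfun_pred m +oo%E.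
Proof.
have normX k (z : circle R) : normc ((z : C) ^+ k) = 1.
  elim: k => [|k ih]; first by rewrite expr0 normc1.
  by rewrite exprS normcM ih mulr1; exact/eqP/circleP.
have mX k : cmeasurable (fun z : circle R => (z : C) ^+ k).
  elim: k => [|k ih]; first exact: cmeasurable_cst.
  rewrite (_ : (fun _ => _) = @circle_val R \* (fun z => (z : C) ^+ k)).
    by apply: cmeasurableM => //; exact: cmeasurable_circle_val.
  by apply/funext => z /=; rewrite exprS.
have XV k (z : circle R) : ((z : C) ^+ k)^-1 = conjc ((z : C) ^+ k).
  move: (normX k z); case: (_ ^+ k) => a b /= /eqP.
  rewrite -sqrtr1 eqr_sqrt ?addr_ge0 ?sqr_ge0// => /eqP ab.
  by rewrite /GRing.inv /= ab !divr1.
apply: (@cLfun_le _ _ _ m +oo%E (leey _) _ (cst 1)).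
- case: n => n; first exact: mX.
  rewrite (_ : (fun _ => _) = @conjc R \o (fun z : circle R => (z : C) ^+ n.+1)).
    exact: cmeasurable_conj.
  by apply/funext => z /=; rewrite -XV.
- apply/andP; split; apply/mem_set; first exact: measurable_cst.
  rewrite /= /finite_norm unlock /Lnorm; case: ifPn => // m0.
  rewrite (_ : _ \o _ = cst 1%E); last by apply/funext => z /=; rewrite normr1.
  by rewrite ess_sup_cst// ltry.
- apply: aeW => z /=; rewrite normr1; case: n => n; first by rewrite normX.
  by rewrite normcV normX invr1.
Qed.

(* The class of z |-> z ^ n; on the circle, z ^ (-1) is the conjugate of z. *)
Definition zpow (n : int) : Linf :=
  \pi_Linf (CLfun (leey 1%E) (circle_exp_subproof n)).

Definition M_ (a : Linf) : L2 -> L2 := cLp_mul a.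

Definition toL2 (a : Linf) : L2 := cLp_incl (lee1n 2) a.

Definition fourier (f : L2) (n : int) : C := inner f (toL2 (zpow n)).

Definition hardy : set L2 := [set f | forall n : int, n < 0 -> fourier f n = 0].

Definition model_space (theta : Linf) : set L2 :=
  [set f | hardy f /\ forall g, (M_ theta @` hardy) g -> inner f g = 0].

(* The definite description of the orthogonal projection onto K (0 where it
   does not exist, which never happens when K is a closed subspace). *)
Definition orth_proj (K : set L2) (f : L2) : L2 :=
  xget 0 [set g | K g /\ forall h, K h -> inner (f - g) h = 0].

Definition bounded_operator (X : L2 -> L2) :=
  exists M : R, forall f, cLp_norm (X f) <= M * cLp_norm f.

Definition commutator (A B : L2 -> L2) : L2 -> L2 := (A \o B) \- (B \o A).

Definition rank_one (p q : L2) : L2 -> L2 := fun f => inner f q *: p.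

Definition unit_disk : set C := [set w | normc w < 1].

(* F is represented in every open disk contained in D by a power series about
   the centre of that disk. *)
Definition analytic_on (D : set C) (F : C -> C) :=
  forall (w0 : C) (r : R), 0 < r -> [set w | normc (w - w0) < r] `<=` D ->
  exists c : nat -> C, forall w, normc (w - w0) < r ->
    series (fun n => c n * (w - w0) ^+ n : C^o) @ \oo --> (F w : C^o).

Definition bounded_on (D : set C) (F : C -> C) :=
  exists M : R, forall w, D w -> normc (F w) <= M.

Definition radial_boundary_value (F : C -> C) (b : Linf) :=
  \forall z \ae m, (F (t%:C%C * circle_val z) : C^o) @[t --> (1 : R)^'-] --> (repr b z : C^o).

(* An inner function F, together with (the class of) its boundary function b. *)
Definition inner_function (F : C -> C) (b : Linf) :=
  [/\ analytic_on unit_disk F, bounded_on unit_disk F,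
      radial_boundary_value F b & \forall z \ae m, normc (repr b z) = 1].

Definition constant_on (D : set C) (F : C -> C) :=
  exists c, forall w, D w -> F w = c.

End Hardy.

(* Main.v *)
Require Import Defs.
From HB Require Import structures.
From mathcomp Require Import all_boot all_order all_algebra.
From mathcomp Require Import all_classical all_reals all_analysis.
From mathcomp Require Import ess_sup_inf measurable_realfun.
From mathcomp Require Import generic_quotient complex ring lra.
Import Order.TTheory GRing.Theory Num.Theory.
Import numFieldNormedType.Exports.
Import ComplexField.Normc.

Set Implicit Arguments.
Unset Strict Implicit.
Unset Printing Implicit Defensive.

Local Open Scope classical_set_scope.
Local Open Scope ring_scope.

Local Notation Re := complex.Re.
Local Notation Im := complex.Im.

(** Write P+ for the orthogonal projection of L^2 onto the Hardy space H^2 and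
z for the coordinate function of the circle. Multiplication by z moves exactly
one Fourier coefficient, that of index -1, from the negative frequencies to the
nonnegative ones; this is the identity [[P+, M_z] = 1 (x) conj z]
([riesz_proj_shift]). Multiplication by theta preserves H^2 and is unitary, so
the projection onto the model space is [P = P+ - M_theta P+ M_(conj theta)]
([orth_proj_model]), and the first identity, conjugated by M_theta, yields
[[P, M_z] = 1 (x) conj z - theta (x) (conj z theta)] ([model_proj_shift]).
Multiplied on the left by M_a, this is the right-hand side of the commutator
identity. An operator X therefore satisfies that identity if and only if
[Y = X - M_a P] commutes with M_z, and the bounded operators that commute with
M_z are the multiplications by bounded functions ([commutant_of_shift]). The
second equivalence is the first one, because
[M_phi P + M_psi (I - P) = M_psi + M_(phi - psi) P].

Three facts carry the analysis.

P+ exists by the projection theorem ([projection_theorem]), which rests on the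
completeness of L^2 ([fast_cauchy_cvg]).

Multiplication by theta preserves H^2 because H^2 is closed and dominated
convergence turns a bounded almost everywhere limit of functions g_n into a
limit of g_n f in L^2 ([bounded_cvg]). This is used twice: for t < 1 the function
z |-> F (t z) is a bounded limit of polynomials in z, which preserve H^2, and
theta is a bounded limit of such functions as t tends to 1
([inner_function_hardy_multiplier]).

As for the commutant, the bounded real functions whose multiplication operator
commutes with Y form an algebra that contains Re z and Im z and is closed under
bounded pointwise limits. The sets whose indicator function lies in it thus form
a sigma-algebra, which contains all Borel sets, and every bounded measurable
function lies in it ([fcommutes_bounded]). The symbol is then Y 1: it is bounded
because Y commutes with the indicator function of the set where it is large
([commutant_symbol_bounded]), and an arbitrary f is brought back to the bounded
case through division by 1 + |f|. *)

(** * Complex numbers and representatives of Lebesgue classes *)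

Section complex_facts.
Variable R : rcfType.
Implicit Types x y : R[i].

Lemma ReD x y : Re (x + y) = Re x + Re y.
Proof. by case: x y => [a b] []. Qed.

Lemma ImD x y : Im (x + y) = Im x + Im y.
Proof. by case: x y => [a b] []. Qed.

Lemma ReN x : Re (- x) = - Re x.
Proof. by case: x. Qed.

Lemma ImN x : Im (- x) = - Im x.
Proof. by case: x. Qed.

Lemma ReM x y : Re (x * y) = Re x * Re y - Im x * Im y.
Proof. by case: x y => [a b] []. Qed.

Lemma ImM x y : Im (x * y) = Re x * Im y + Im x * Re y.
Proof. by case: x y => [a b] []. Qed.

Lemma Re_conj x : Re (conjc x) = Re x.
Proof. by case: x. Qed.

Lemma Im_conj x : Im (conjc x) = - Im x.
Proof. by case: x. Qed.

Lemma conjcD x y : conjc (x + y) = conjc x + conjc y.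
Proof. exact: rmorphD. Qed.

Lemma conjcM x y : conjc (x * y) = conjc x * conjc y.
Proof. exact: rmorphM. Qed.

Lemma conjcN x : conjc (- x) = - conjc x.
Proof. exact: rmorphN. Qed.

Lemma realcM (r s : R) : (r * s)%:C%C = r%:C%C * s%:C%C.
Proof. exact: rmorphM. Qed.

Lemma realcB (r s : R) : (r - s)%:C%C = r%:C%C - s%:C%C.
Proof. exact: rmorphB. Qed.

Lemma complex_ext x y : Re x = Re y -> Im x = Im y -> x = y.
Proof. by case: x y => [a b] [c d] /= -> ->. Qed.

Lemma sqr_normcE x : normc x ^+ 2 = Re x ^+ 2 + Im x ^+ 2.
Proof. by case: x => a b /=; rewrite sqr_sqrtr// addr_ge0 ?sqr_ge0. Qed.

Lemma normc_conj x : normc (conjc x) = normc x.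
Proof. by case: x => a b /=; rewrite sqrrN. Qed.

Lemma normRe x : `|Re x| <= normc x.
Proof.
by rewrite -ler_sqr ?nnegrE ?normc_ge0// sqr_normcE real_normK ?num_real// lerDl sqr_ge0.
Qed.

Lemma normIm x : `|Im x| <= normc x.
Proof.
by rewrite -ler_sqr ?nnegrE ?normc_ge0// sqr_normcE real_normK ?num_real// lerDr sqr_ge0.
Qed.

Lemma normc_real (r : R) : normc (r%:C%C) = `|r|.
Proof. by rewrite /= expr0n addr0 sqrtr_sqr. Qed.

Lemma mul_conjc x : x * conjc x = (normc x ^+ 2)%:C%C.
Proof.
rewrite sqr_normcE; apply: complex_ext.
  by rewrite ReM Re_conj Im_conj [RHS]/=; ring.
by rewrite ImM Re_conj Im_conj [RHS]/=; ring.
Qed.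

Lemma normcX x n : normc (x ^+ n) = normc x ^+ n.
Proof. by elim: n => [|n ih]; rewrite ?expr0 ?normc1// !exprS normcM ih. Qed.

Lemma normcB x y : normc (x - y) = normc (y - x).
Proof. by rewrite -normcN opprB. Qed.

Lemma dist_normc x y : `|normc x - normc y| <= normc (x - y).
Proof.
have := le_normcD (x - y) y; have := le_normcD (y - x) x.
rewrite !subrK (normcB y) => h1 h2; rewrite ler_norml; apply/andP; split; lra.
Qed.

Lemma normc_sum (I : Type) (s : seq I) (f : I -> R[i]) :
  normc (\sum_(i <- s) f i) <= \sum_(i <- s) normc (f i).
Proof.
elim: s => [|i s ih]; first by rewrite !big_nil normc0.
by rewrite !big_cons (le_trans (le_normcD _ _))// lerD2l.
Qed.

End complex_facts.

Lemma cmeasurableB d (T : measurableType d) (R : realType) (f g : T -> R[i]) :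
  cmeasurable f -> cmeasurable g -> cmeasurable (fun z => f z - g z).
Proof.
move=> mf mg; rewrite (_ : (fun _ => _) = f \+ (cst (-1) \* g)).
  by apply: cmeasurableD => //; apply: cmeasurableM => //; exact: cmeasurable_cst.
by apply/funext => z /=; rewrite mulN1r.
Qed.

Section Lp_facts.
Context d (T : measurableType d) (R : realType).
Variables (mu : {measure set T -> \bar R}) (p : \bar R) (p1 : (1 <= p)%E).
Local Notation Loo := (cLp mu (leey 1%E)).
Local Notation L := (cLp mu p1).
Local Open Scope quotient_scope.

(** Every identity between classes below is proved through this lemma, by pointwise
computation on the representatives on a set of full measure. *)
Lemma cLp_ext (f g : L) : (\forall z \ae mu, repr f z = repr g z) -> f = g.
Proof.
move=> fg; rewrite -[f]reprK -[g]reprK; apply/cLp_eqP.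
by apply: filterS fg => z h _.
Qed.

Lemma repr_pi (f : cLfun mu p1) : \forall z \ae mu, repr (\pi_L f) z = f z.
Proof.
have /cLp_eqP := reprK (\pi_L f).
by apply: filterS => z; exact.
Qed.

Lemma reprD (f g : L) : \forall z \ae mu, repr (f + g) z = repr f z + repr g z.
Proof.
by rewrite -[f in f + g]reprK -[g in _ + g]reprK -cLp_piD; exact: repr_pi.
Qed.

Lemma reprZ (c : R[i]) (f : L) : \forall z \ae mu, repr (c *: f) z = c * repr f z.
Proof. exact: repr_pi. Qed.

Lemma repr0 : \forall z \ae mu, repr (0 : L) z = 0.
Proof.
have := reprZ 0 (0 : L); apply: filterS => z.
by rewrite scale0r mul0r.
Qed.

Lemma reprN (f : L) : \forall z \ae mu, repr (- f) z = - repr f z.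
Proof.
have := reprZ (-1) f; apply: filterS => z.
by rewrite scaleN1r mulN1r.
Qed.

Lemma reprM (a : Loo) (f : L) :
  \forall z \ae mu, repr (cLp_mul a f) z = repr a z * repr f z.
Proof. exact: repr_pi. Qed.

Lemma repr_cmeasurable (f : L) : cmeasurable (repr f).
Proof. by have /cLfun_predP[] := cLfunP (repr f). Qed.

(** The class of a function, with the default value 0 outside L^p, so that no proof
of membership has to be carried in terms. *)
Definition toLp (f : T -> R[i]) : L :=
  if pselect (f \in cLfun_pred mu p) is left h then \pi_L (CLfun p1 h) else 0.

Lemma toLpK f : f \in cLfun_pred mu p ->
  \forall z \ae mu, repr (toLp f) z = f z.
Proof. by rewrite /toLp; case: pselect => // h _; exact: repr_pi. Qed.

Lemma Linf_bounded (a : Loo) :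
  exists2 M : R, 0 <= M & \forall z \ae mu, normc (repr a z) <= M.
Proof.
have /cLfun_predP[_] := cLfunP (repr a).
rewrite /finite_norm unlock /Lnorm; case: ifPn => [_ /ess_supr_bounded[M fM]|mu0 _].
  exists `|M| => //; apply: filterS fM => z /=; rewrite ger0_norm ?normc_ge0// => h.
  by rewrite (le_trans h)// ler_norm.
exists 0 => //; exists setT; split => //.
by apply/eqP; rewrite eq_le measure_ge0 andbT leNgt.
Qed.

Lemma bounded_cLfun (f : T -> R[i]) (M : R) : cmeasurable f ->
  (\forall z \ae mu, normc (f z) <= M) -> f \in cLfun_pred mu +oo%E.
Proof.
move=> mf fM; apply: (@cLfun_le _ _ _ mu +oo%E (leey _) _ (cst M)) => //.
- apply/andP; split; apply/mem_set; first exact: measurable_cst.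
  rewrite /= /finite_norm unlock /Lnorm; case: ifPn => // m0.
  rewrite (_ : _ \o _ = cst `|M|%:E)//.
  by rewrite ess_sup_cst// ltry.
- by apply: filterS fM => z h; rewrite (le_trans h)// ler_norm.
Qed.

End Lp_facts.

(** * The inner product of L^2 of the circle *)

Section square_integrable.
Context d (T : measurableType d) (R : realType).
Variable mu : {measure set T -> \bar R}.

Lemma cLfun2_integrable_sqr (f : T -> R[i]) : f \in cLfun_pred mu 2%:E ->
  mu.-integrable setT (EFin \o (fun z => normc (f z) ^+ 2)).
Proof. by move=> /normc_Lfun; exact: Lfun2_integrable_sqr. Qed.

Lemma cLfun2_of_integral (f : T -> R[i]) : cmeasurable f ->
  (\int[mu]_z (normc (f z) ^+ 2)%:E < +oo)%E -> f \in cLfun_pred mu 2%:E.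
Proof.
move=> mf fy; apply/cLfun_predP; split => //.
rewrite /finite_norm unlock /Lnorm poweR_lty//.
rewrite (le_lt_trans _ fy)// le_eqVlt; apply/orP; left; apply/eqP.
apply: eq_integral => z _ /=.
by rewrite ger0_norm ?normc_ge0// powR_mulrn ?normc_ge0.
Qed.

Lemma cLfun2_ReIm (f : T -> R[i]) : f \in cLfun_pred mu 2%:E ->
  (@Re R \o f) \in Lfun mu 2%:E /\ (@Im R \o f) \in Lfun mu 2%:E.
Proof.
have h12 : (1 <= 2%:E :> \bar R)%E by rewrite lee_fin ler1n.
move=> hf; have /cLfun_predP[[mr mi] _] := hf.
have /andP[/set_mem mn /set_mem fn] := normc_Lfun hf.
split; apply/andP; split; apply/mem_set => //.
- apply: (finite_norm_ae_le h12 _ mn _ fn) => //.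
  by apply: aeW => z; rewrite /= [leRHS]ger0_norm ?normc_ge0// normRe.
- apply: (finite_norm_ae_le h12 _ mn _ fn) => //.
  by apply: aeW => z; rewrite /= [leRHS]ger0_norm ?normc_ge0// normIm.
Qed.

Definition cintegrable (h : T -> R[i]) :=
  mu.-integrable setT (EFin \o (fun z => Re (h z))) /\
  mu.-integrable setT (EFin \o (fun z => Im (h z))).

(** The real and imaginary parts of f conj(g) are sums of products of real L^2
functions. *)
Lemma cintegrable_mul (f g : T -> R[i]) : f \in cLfun_pred mu 2%:E ->
  g \in cLfun_pred mu 2%:E -> cintegrable (fun z => f z * conjc (g z)).
Proof.
move=> /cLfun2_ReIm[fr fi] /cLfun2_ReIm[gr gi].
have h (u v : T -> R) : u \in Lfun mu 2%:E -> v \in Lfun mu 2%:E ->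
    mu.-integrable setT (EFin \o (u \* v)).
  by move=> hu hv; apply/Lfun1_integrable; exact: Lfun2_mul_Lfun1.
split.
- rewrite (_ : _ \o _ = (EFin \o ((@Re R \o f) \* (@Re R \o g))%R) \+
                        (EFin \o ((@Im R \o f) \* (@Im R \o g))%R))%E.
    by apply: integrableD => //; exact: h.
  by apply/funext => z; rewrite /= ReM Re_conj Im_conj mulrN opprK EFinD.
- rewrite (_ : _ \o _ = (EFin \o ((@Im R \o f) \* (@Re R \o g))%R) \-
                        (EFin \o ((@Re R \o f) \* (@Im R \o g))%R))%E.
    by apply: integrableB => //; exact: h.
  apply/funext => z; rewrite /= ImM Re_conj Im_conj mulrN -EFinB; congr EFin.
  by rewrite addrC.
Qed.

End square_integrable.

Lemma integrable_scale d (T : measurableType d) (R : realType)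
    (mu : {measure set T -> \bar R}) (r : R) (u : T -> R) :
  mu.-integrable setT (EFin \o u) ->
  mu.-integrable setT (EFin \o (fun z => r * u z)).
Proof.
move=> iu; rewrite (_ : _ \o _ = (fun z => r%:E * (EFin \o u) z)%E)//.
exact: integrableZl.
Qed.

Section inner_product.
Context (R : realType).
Local Notation m := (circle_measure R).
Local Notation L2 := (L2 R).
Local Notation Linf := (Linf R).
Local Notation C := R[i].
Local Open Scope quotient_scope.
Implicit Types (f g : L2) (a b : Linf) (c : C).

Lemma repr_L2 f : (repr f : circle R -> C) \in cLfun_pred m 2%:E.
Proof. exact: cLfunP. Qed.

Lemma cintegralD (u v : circle R -> C) : cintegrable m u -> cintegrable m v ->
  cintegral (fun z => u z + v z) = cintegral u + cintegral v.
Proof.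
move=> [ur ui] [vr vi]; rewrite /cintegral; apply: complex_ext.
  rewrite ReD /= -RintegralD//; apply: eq_Rintegral => z _; exact: ReD.
rewrite ImD /= -RintegralD//; apply: eq_Rintegral => z _; exact: ImD.
Qed.

Lemma cintegralZ c (u : circle R -> C) : cintegrable m u ->
  cintegral (fun z => c * u z) = c * cintegral u.
Proof.
move=> [ur ui]; rewrite /cintegral; apply: complex_ext.
  rewrite ReM /= -!RintegralZl// -RintegralB//.
  - by apply: eq_Rintegral => z _; exact: ReM.
  - exact: integrable_scale.
  - exact: integrable_scale.
rewrite ImM /= -!RintegralZl// -RintegralD//.
- by apply: eq_Rintegral => z _; exact: ImM.
- exact: integrable_scale.
- exact: integrable_scale.
Qed.

Lemma ae_eq_cintegral (u v : circle R -> C) : cmeasurable u -> cmeasurable v ->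
  (\forall z \ae m, u z = v z) -> cintegral u = cintegral v.
Proof.
move=> [ur ui] [vr vi] uv; rewrite /cintegral /Rintegral.
congr (Complex (fine _) (fine _)); apply: ae_eq_integral => //.
- exact/measurable_EFinP.
- exact/measurable_EFinP.
- by apply: filterS uv => z -> _.
- exact/measurable_EFinP.
- exact/measurable_EFinP.
- by apply: filterS uv => z -> _.
Qed.

Lemma cmeasurable_prod_conj f g : cmeasurable (fun z => repr f z * conjc (repr g z)).
Proof.
apply: (cmeasurableM (repr_cmeasurable f)).
exact: (cmeasurable_conj (repr_cmeasurable g)).
Qed.

Lemma inner_ae f g (u : circle R -> C) : cmeasurable u ->
  (\forall z \ae m, repr f z * conjc (repr g z) = u z) -> inner f g = cintegral u.
Proof. by move=> mu fgu; apply: ae_eq_cintegral => //; exact: cmeasurable_prod_conj. Qed.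

Lemma inner_integrable f g : cintegrable m (fun z => repr f z * conjc (repr g z)).
Proof. by apply: cintegrable_mul; exact: repr_L2. Qed.

Lemma innerDl f g h : inner (f + g) h = inner f h + inner g h.
Proof.
rewrite /inner -cintegralD; [|exact: inner_integrable..].
apply: inner_ae.
  by apply: cmeasurableD; exact: cmeasurable_prod_conj.
by have := reprD f g; apply: filterS => z ->; rewrite mulrDl.
Qed.

Lemma innerZl c f g : inner (c *: f) g = c * inner f g.
Proof.
rewrite /inner -cintegralZ; last exact: inner_integrable.
apply: inner_ae.
  by apply: cmeasurableM; [exact: cmeasurable_cst|exact: cmeasurable_prod_conj].
by have := reprZ c f; apply: filterS => z ->; rewrite mulrA.
Qed.

Lemma inner_conj f g : inner g f = conjc (inner f g).
Proof.
rewrite /inner /cintegral; apply: complex_ext => /=.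
  by apply: eq_Rintegral => z _; rewrite !ReM !Re_conj !Im_conj; ring.
rewrite -[RHS]mulN1r -RintegralZl//; last by have [] := inner_integrable f g.
by apply: eq_Rintegral => z _; rewrite !ImM !Re_conj !Im_conj; ring.
Qed.

Lemma innerDr f g h : inner f (g + h) = inner f g + inner f h.
Proof. by rewrite inner_conj innerDl conjcD -!inner_conj. Qed.

Lemma innerZr c f g : inner f (c *: g) = conjc c * inner f g.
Proof. by rewrite inner_conj innerZl conjcM -inner_conj. Qed.

Lemma inner0l f : inner 0 f = 0.
Proof. by rewrite -(scale0r (0 : L2)) innerZl mul0r. Qed.

Lemma inner0r f : inner f 0 = 0.
Proof. by rewrite inner_conj inner0l conjc0. Qed.

Lemma innerNl f g : inner (- f) g = - inner f g.
Proof. by rewrite -scaleN1r innerZl mulN1r. Qed.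

Lemma innerNr f g : inner f (- g) = - inner f g.
Proof. by rewrite inner_conj innerNl conjcN -inner_conj. Qed.

Lemma innerBl f g h : inner (f - g) h = inner f h - inner g h.
Proof. by rewrite innerDl innerNl. Qed.

Lemma innerBr f g h : inner f (g - h) = inner f g - inner f h.
Proof. by rewrite innerDr innerNr. Qed.

Lemma cLp_norm_ge0 f : 0 <= cLp_norm f.
Proof. by apply: fine_ge0; exact: Lnorm_ge0. Qed.

Lemma integral_normc_sqr f :
  (\int[m]_z (normc (repr f z) ^+ 2)%:E)%E = (cLp_norm f ^+ 2)%:E.
Proof.
have /cLfun_predP[_] := repr_L2 f; rewrite /finite_norm => fy.
rewrite -powR_mulrn ?cLp_norm_ge0// -poweR_EFin /cLp_norm fineK; last first.
  by rewrite ge0_fin_numE ?Lnorm_ge0.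
rewrite poweR_Lnorm//; apply: eq_integral => z _ /=.
by rewrite ger0_norm ?normc_ge0// powR_mulrn ?normc_ge0.
Qed.

Lemma cLp_norm_sqr f : cLp_norm f ^+ 2 = \int[m]_z (normc (repr f z) ^+ 2).
Proof. by rewrite /Rintegral integral_normc_sqr. Qed.

Lemma innerE f : inner f f = (cLp_norm f ^+ 2)%:C%C.
Proof.
rewrite cLp_norm_sqr /inner /cintegral; apply: complex_ext => /=.
  by apply: eq_Rintegral => z _; rewrite mul_conjc.
under eq_Rintegral do rewrite mul_conjc.
by rewrite /Rintegral integral0.
Qed.

Lemma cLp_norm_eq0 f : cLp_norm f = 0 -> f = 0.
Proof.
move=> f0; apply: cLp_ext.
have /(ae_eq_integral_abs m measurableT) h : measurable_fun setT
    (EFin \o (fun z => normc (repr f z) ^+ 2)).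
  by have /integrableP[] := cLfun2_integrable_sqr (repr_L2 f).
have : (\int[m]_z `|(normc (repr f z) ^+ 2)%:E| = 0)%E.
  under eq_integral do rewrite /= ger0_norm ?sqr_ge0//.
  by rewrite integral_normc_sqr f0 expr0n.
move=> /h; apply: filterS2 (repr0 m (lee1n 2)) => z -> /(_ Logic.I) /= [].
by move=> /eqP; rewrite sqrf_eq0 => /eqP/eq0_normc.
Qed.

End inner_product.

(** * Norm inequalities and multiplication operators *)

Section norm_and_multipliers.
Context (R : realType).
Local Notation m := (circle_measure R).
Local Notation L2 := (L2 R).
Local Notation Linf := (Linf R).
Local Notation C := R[i].
Local Open Scope quotient_scope.
Implicit Types (f g h : L2) (a b : Linf) (c : C).
Local Notation N := (@cLp_norm _ _ _ m _ (lee1n 2)).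

Lemma norm_inner f : N f ^+ 2 = Re (inner f f).
Proof. by rewrite innerE. Qed.

Lemma le_norm f (r : R) : 0 <= r -> N f ^+ 2 <= r ^+ 2 -> N f <= r.
Proof. by move=> r0; rewrite ler_sqr// nnegrE cLp_norm_ge0. Qed.

Lemma normZ c f : N (c *: f) = normc c * N f.
Proof.
apply/eqP; rewrite -(@eqrXn2 _ 2)// ?cLp_norm_ge0 ?mulr_ge0 ?cLp_norm_ge0 ?normc_ge0//.
apply/eqP/complexI; rewrite -innerE innerZl innerZr mulrA mul_conjc innerE exprMn.
by rewrite -realcM.
Qed.

Lemma normN f : N (- f) = N f.
Proof. by rewrite -scaleN1r normZ normcN normc1 mul1r. Qed.

Lemma norm0 : N 0 = 0.
Proof. by rewrite -(scale0r (0 : L2)) normZ normc0 mul0r. Qed.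

Lemma normBC f g : N (f - g) = N (g - f).
Proof. by rewrite -normN opprB. Qed.

(** Expand the squared norm of |g|^2 f - <f, g> g, which is |g|^2 times the
difference of the squares of the two sides. *)
Lemma cauchy_schwarz f g : normc (inner f g) <= N f * N g.
Proof.
have [g0|g0] := eqVneq (N g) 0.
  by rewrite (cLp_norm_eq0 g0) inner0r norm0 mulr0 normc0.
have gpos : 0 < N g ^+ 2 by rewrite exprn_gt0// lt0r g0 cLp_norm_ge0.
rewrite -ler_sqr ?nnegrE ?normc_ge0 ?mulr_ge0 ?cLp_norm_ge0//.
have : 0 <= N ((N g ^+ 2)%:C%C *: f - inner f g *: g) ^+ 2 by exact: sqr_ge0.
have -> : N ((N g ^+ 2)%:C%C *: f - inner f g *: g) ^+ 2 =
          N g ^+ 2 * ((N f * N g) ^+ 2 - normc (inner f g) ^+ 2).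
  apply: complexI; rewrite -[LHS]innerE innerBl !innerBr !innerZl !innerZr.
  rewrite conjc_real (inner_conj f g) !innerE.
  move: (mul_conjc (inner f g)); set x := inner f g => hx.
  rewrite exprMn; move: (N f ^+ 2) (N g ^+ 2) (normc x ^+ 2) hx => F G X hx.
  rewrite [in RHS]realcM realcB realcM -hx; ring.
by rewrite pmulr_rge0// subr_ge0.
Qed.

Lemma norm_sqrD f g : N (f + g) ^+ 2 = N f ^+ 2 + N g ^+ 2 + 2 * Re (inner f g).
Proof.
rewrite norm_inner innerDl !innerDr !ReD -!norm_inner (inner_conj f g) Re_conj.
by ring.
Qed.

Lemma normD f g : N (f + g) <= N f + N g.
Proof.
apply: le_norm; first by rewrite addr_ge0 ?cLp_norm_ge0.
rewrite norm_sqrD.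
have := le_trans (le_trans (ler_norm _) (normRe (inner f g))) (cauchy_schwarz f g).
set x := Re _; nra.
Qed.

Lemma normB_trans h f g : N (f - g) <= N (f - h) + N (h - g).
Proof. by rewrite -(subrKA h) normD. Qed.

Lemma parallelogram f g :
  N (f - g) ^+ 2 + N (f + g) ^+ 2 = 2 * (N f ^+ 2 + N g ^+ 2).
Proof. by rewrite !norm_sqrD normN innerNr ReN; ring. Qed.

Lemma norm_le_ae f g (B : R) : 0 <= B ->
  (\forall z \ae m, normc (repr f z) <= B * normc (repr g z)) -> N f <= B * N g.
Proof.
move=> B0 fg; apply: le_norm; first by rewrite mulr_ge0 ?cLp_norm_ge0.
rewrite exprMn !cLp_norm_sqr -RintegralZl//; last exact: cLfun2_integrable_sqr (repr_L2 g).
have ig : m.-integrable setT (EFin \o (fun z => B ^+ 2 * (normc (repr g z) ^+ 2))).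
  by apply: integrable_scale; exact: cLfun2_integrable_sqr (repr_L2 g).
have if_ := cLfun2_integrable_sqr (repr_L2 f).
rewrite /Rintegral fine_le//; [exact: integrable_fin_num..|].
apply: ae_ge0_le_integral => //.
- by move=> z _; rewrite lee_fin sqr_ge0.
- by have /integrableP[] := if_.
- by move=> z _; rewrite lee_fin mulr_ge0// sqr_ge0.
- by have /integrableP[] := ig.
- apply: filterS fg => z h _; rewrite lee_fin -exprMn ler_sqr// nnegrE ?normc_ge0//.
  by rewrite mulr_ge0// normc_ge0.
Qed.

Lemma M_bounded a : exists2 B : R, 0 <= B & forall f, N (M_ a f) <= B * N f.
Proof.
have [B B0 aB] := Linf_bounded a; exists B => // f; apply: norm_le_ae => //.
apply: filterS2 aB (reprM a f) => z az ->.
by rewrite normcM ler_wpM2r// normc_ge0.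
Qed.

Lemma M_D a f g : M_ a (f + g) = M_ a f + M_ a g.
Proof.
apply: cLp_ext; near=> z.
rewrite (near (reprM a (f + g)) z)// (near (reprD f g) z)//.
rewrite (near (reprD (M_ a f) (M_ a g)) z)// (near (reprM a f) z)//.
by rewrite (near (reprM a g) z)// mulrDr.
Unshelve. all: by end_near. Qed.

Lemma M_Z a c f : M_ a (c *: f) = c *: M_ a f.
Proof.
apply: cLp_ext; near=> z.
rewrite (near (reprM a (c *: f)) z)// (near (reprZ c f) z)//.
by rewrite (near (reprZ c (M_ a f)) z)// (near (reprM a f) z)// mulrCA.
Unshelve. all: by end_near. Qed.

Lemma M_N a f : M_ a (- f) = - M_ a f.
Proof. by rewrite -scaleN1r M_Z scaleN1r. Qed.

Lemma M_B a f g : M_ a (f - g) = M_ a f - M_ a g.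
Proof. by rewrite M_D M_N. Qed.

Lemma M_addl a b f : M_ (a + b) f = M_ a f + M_ b f.
Proof.
apply: cLp_ext; near=> z.
rewrite (near (reprM (a + b) f) z)// (near (reprD a b) z)//.
rewrite (near (reprD (M_ a f) (M_ b f)) z)// (near (reprM a f) z)//.
by rewrite (near (reprM b f) z)// mulrDl.
Unshelve. all: by end_near. Qed.

Lemma M_mul a b f : M_ (cLp_mul a b) f = M_ a (M_ b f).
Proof.
apply: cLp_ext; near=> z.
rewrite (near (reprM (cLp_mul a b) f) z)// (near (reprM a b) z)//.
by rewrite (near (reprM a (M_ b f)) z)// (near (reprM b f) z)// mulrA.
Unshelve. all: by end_near. Qed.

Lemma M_comm a b f : M_ a (M_ b f) = M_ b (M_ a f).
Proof.
apply: cLp_ext; near=> z.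
rewrite (near (reprM a (M_ b f)) z)// (near (reprM b f) z)//.
by rewrite (near (reprM b (M_ a f)) z)// (near (reprM a f) z)// mulrCA.
Unshelve. all: by end_near. Qed.

Definition Linf_conj a : Linf := toLp m (leey 1%E) (@conjc R \o repr a).

Lemma repr_conj a : \forall z \ae m, repr (Linf_conj a) z = conjc (repr a z).
Proof.
apply: toLpK; have [B _ aB] := Linf_bounded a; apply: (@bounded_cLfun _ _ _ _ _ B).
  exact: (cmeasurable_conj (repr_cmeasurable a)).
by apply: filterS aB => z; rewrite /= normc_conj.
Qed.

Lemma inner_Ml a f g : inner (M_ a f) g = inner f (M_ (Linf_conj a) g).
Proof.
apply: inner_ae; first exact: cmeasurable_prod_conj.
near=> z; rewrite (near (reprM a f) z)// (near (reprM (Linf_conj a) g) z)//.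
by rewrite (near (repr_conj a) z)// conjcM conjcK mulrCA mulrA.
Unshelve. all: by end_near. Qed.

Lemma inner_Mr a f g : inner f (M_ a g) = inner (M_ (Linf_conj a) f) g.
Proof. by rewrite inner_conj inner_Ml -inner_conj. Qed.

Definition unimodular a := \forall z \ae m, normc (repr a z) = 1.

Lemma unimodular_conjK a f : unimodular a -> M_ (Linf_conj a) (M_ a f) = f.
Proof.
move=> a1; apply: cLp_ext; near=> z.
rewrite (near (reprM (Linf_conj a) (M_ a f)) z)// (near (reprM a f) z)//.
rewrite (near (repr_conj a) z)// mulrA [conjc _ * _]mulrC mul_conjc (near a1 z)//.
by rewrite expr1n mul1r.
Unshelve. all: by end_near. Qed.

Lemma repr_zpow n : \forall z \ae m, repr (zpow R n) z = (z : C) ^ n.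
Proof. exact: repr_pi. Qed.

Lemma normc_circle (z : circle R) : normc (z : C) = 1.
Proof. exact/eqP/circleP. Qed.

Lemma circle_neq0 (z : circle R) : (z : C) != 0.
Proof.
by apply/eqP => z0; have := normc_circle z; rewrite z0 normc0 => /esym/eqP; rewrite oner_eq0.
Qed.

Lemma conj_circle (z : circle R) : conjc (z : C) = (z : C)^-1.
Proof.
apply: (mulfI (circle_neq0 z)); rewrite mul_conjc normc_circle expr1n divff//.
exact: circle_neq0.
Qed.

Lemma conj_circle_expz (z : circle R) (n : int) :
  conjc ((z : C) ^ n) = (z : C) ^ (- n).
Proof.
have h k : conjc ((z : C) ^+ k) = (z : C) ^- k.
  by rewrite -exprVn -conj_circle; elim: k => [|k ih]; rewrite ?expr0 ?conjc1// !exprS conjcM ih.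
case: n => n; first by rewrite -exprnN h.
by rewrite NegzE opprK -exprnN conjc_inv h invrK.
Qed.

Lemma repr_toL2 a : \forall z \ae m, repr (toL2 a) z = repr a z.
Proof. exact: repr_pi. Qed.

Lemma M_zpow_toL2 k n : M_ (zpow R k) (toL2 (zpow R n)) = toL2 (zpow R (k + n)).
Proof.
apply: cLp_ext; near=> z.
rewrite (near (reprM (zpow R k) (toL2 (zpow R n))) z)// (near (repr_zpow k) z)//.
rewrite (near (repr_toL2 (zpow R n)) z)// (near (repr_toL2 (zpow R (k + n))) z)//.
rewrite (near (repr_zpow n) z)// (near (repr_zpow (k + n)) z)//.
by rewrite expfzDr// circle_neq0.
Unshelve. all: by end_near. Qed.

Lemma M_toL2 a : M_ a (toL2 (zpow R 0)) = toL2 a.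
Proof.
apply: cLp_ext; near=> z.
rewrite (near (reprM a (toL2 (zpow R 0))) z)//.
rewrite (near (repr_toL2 (zpow R 0)) z)// (near (repr_toL2 a) z)//.
by rewrite (near (repr_zpow 0) z)// mulr1.
Unshelve. all: by end_near. Qed.

Lemma M_conj_zpow n f : M_ (Linf_conj (zpow R n)) f = M_ (zpow R (- n)) f.
Proof.
apply: cLp_ext; near=> z.
rewrite (near (reprM (Linf_conj (zpow R n)) f) z)//.
rewrite (near (reprM (zpow R (- n)) f) z)// (near (repr_conj (zpow R n)) z)//.
by rewrite (near (repr_zpow n) z)// (near (repr_zpow (- n)) z)// conj_circle_expz.
Unshelve. all: by end_near. Qed.

Lemma M_zpowK n f : M_ (zpow R (- n)) (M_ (zpow R n) f) = f.
Proof.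
rewrite -M_conj_zpow unimodular_conjK//.
apply: filterS (repr_zpow n) => z ->.
case: n => n; first by rewrite -exprnP normcX normc_circle expr1n.
by rewrite NegzE -exprnN normcV normcX normc_circle expr1n invr1.
Qed.

End norm_and_multipliers.

(** * Pointwise convergence of rapidly Cauchy sequences *)

(** By d <= 2^-k + 2^k d^2, square summability of the increments with weights 2^k
makes the increments absolutely summable. *)
Lemma cvg_of_weighted_increments (R : realType) (x : nat -> R) (c : R) :
  (forall n, \sum_(0 <= k < n) 2 ^+ k * (x k.+1 - x k) ^+ 2 <= c) -> cvgn x.
Proof.
move=> xc.
have half_lt1 : `|2^-1| < 1 :> R by rewrite ger0_norm// invf_lt1// ltr1n.
have cx : cvgn (series (telescope x)).
  apply: normed_cvg; apply: nondecreasing_is_cvgn.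
    by apply: nondecreasing_series => k * /=; exact: normr_ge0.
  exists (1 * (1 - 2^-1)^-1 + c) => _ [n _ <-].
  apply: (@le_trans _ _ (series (geometric 1 2^-1) n +
      \sum_(0 <= k < n) 2 ^+ k * (x k.+1 - x k) ^+ 2)).
    rewrite /series/= -big_split/=; apply: ler_sum => k _.
    rewrite mul1r exprVn /telescope -[leRHS]addr0.
    set a : R := 2 ^+ k; set d := x k.+1 - x k.
    have a0 : 0 < a by exact: exprn_gt0.
    rewrite -(ler_pM2l a0) addr0 mulrDr divff ?gt_eqF// mulrA -expr2 -exprMn.
    rewrite -[X in X * _](gtr0_norm a0) -normrM -[X in _ + X]real_normK ?num_real//.
    move: `|a * d| => t; nra.
  by apply: lerD => //; exact: geometric_le_lim.
rewrite (_ : x = (fun n => x 0%N + series (telescope x) n)).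
  by apply: is_cvgD => //; exact: is_cvg_cst.
by apply/funext => n; exact: eq_sum_telescope.
Qed.

Section convergence.
Context (R : realType).
Local Notation m := (circle_measure R).
Local Notation L2 := (L2 R).
Local Notation Linf := (Linf R).
Local Notation C := R[i].
Local Open Scope quotient_scope.
Local Notation N := (@cLp_norm _ _ _ m _ (lee1n 2)).

Lemma fast_cauchy_tail (u : nat -> L2) :
  (forall n, N (u n.+1 - u n) <= 2^-1 ^+ n) ->
  forall n k, N (u (n + k)%N - u n) <= 2 * 2^-1 ^+ n.
Proof.
move=> uc n k.
suff h : N (u (n + k)%N - u n) <= 2 * 2^-1 ^+ n - 2 * 2^-1 ^+ (n + k).
  by rewrite (le_trans h)// gerBl mulr_ge0// exprn_ge0// invr_ge0.
elim: k => [|k ih]; first by rewrite addn0 !subrr norm0.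
rewrite addnS (le_trans (normB_trans (u (n + k)%N) _ _))//.
have := uc (n + k)%N; rewrite exprS; move: ih; lra.
Qed.

(** The sum over k of 2^k |u_(k+1) - u_k|^2 has integral at most the sum of the
2^-k, so it is finite almost everywhere, where the previous lemma applies. *)
Lemma fast_cauchy_cvg_ae (u : nat -> L2) :
  (forall n, N (u n.+1 - u n) <= 2^-1 ^+ n) ->
  \forall z \ae m, cvgn (fun n => Re (repr (u n) z)) /\ cvgn (fun n => Im (repr (u n) z)).
Proof.
move=> uc.
pose w k z := 2 ^+ k * normc (repr (u k.+1 - u k) z) ^+ 2.
have w0 k z : 0 <= w k z by apply: mulr_ge0; [exact: exprn_ge0|exact: sqr_ge0].
have iw k : m.-integrable setT (EFin \o w k).
  by apply: integrable_scale; exact: cLfun2_integrable_sqr (repr_L2 _).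
have mw k : measurable_fun setT (EFin \o w k) by have /integrableP[] := iw k.
pose W z := (\sum_(0 <= k <oo) (w k z)%:E)%E.
have W0 z : (0 <= W z)%E by apply: nneseries_ge0 => k _ _; rewrite lee_fin.
have iW : m.-integrable setT W.
  apply/integrableP; split.
    by apply: (ge0_emeasurable_sum (P := xpredT)) => [k z _ _|k _]; [exact: w0|exact: mw].
  under eq_integral do rewrite gee0_abs//.
  rewrite integral_nneseries//; last by move=> k z _; rewrite lee_fin.
  apply: (@le_lt_trans _ _ 2%:E); last exact: ltry.
  apply: lime_le.
    by apply: is_cvg_nneseries => k _ _; apply: integral_ge0 => z _; rewrite lee_fin.
  apply: nearW => n.
  apply: (@le_trans _ _ (series (geometric 1 2^-1) n)%:E).
    rewrite /series/= -sumEFin; apply: lee_sum => k _.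
    rewrite -[leLHS]fineK; last exact: (integrable_fin_num measurableT (iw k)).
    rewrite lee_fin -[fine _]/(\int[m]_z w k z) RintegralZl//; last first.
      exact: cLfun2_integrable_sqr (repr_L2 _).
    rewrite -cLp_norm_sqr mul1r.
    apply: (@le_trans _ _ (2 ^+ k * (2^-1 ^+ k) ^+ 2)).
      by rewrite ler_pM2l ?exprn_gt0// ler_sqr ?nnegrE ?cLp_norm_ge0 ?exprn_ge0 ?invr_ge0.
    by rewrite expr2 mulrA -exprMn divff// expr1n mul1r.
  rewrite lee_fin (le_trans (geometric_le_lim _ _ _ _))//.
    by rewrite ger0_norm// invf_lt1// ltr1n.
  by rewrite mul1r (_ : 1 - 2^-1 = 2^-1 :> R) ?invrK//; lra.
have aeD : \forall z \ae m, forall k,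
    repr (u k.+1 - u k) z = repr (u k.+1) z - repr (u k) z.
  apply: ae_foralln => k; near=> z.
  by rewrite (near (reprD (u k.+1) (- u k)) z)// (near (reprN (u k)) z).
near=> z.
have Wz : W z \is a fin_num.
  by apply: (near (integrable_ae measurableT iW) z).
have dz : forall k, repr (u k.+1 - u k) z = repr (u k.+1) z - repr (u k) z.
  exact: (near aeD z).
have wz n : \sum_(0 <= k < n) w k z <= fine (W z).
  rewrite -lee_fin fineK// -sumEFin.
  by apply: nneseries_lim_ge => k _ _; rewrite lee_fin.
split; apply: (@cvg_of_weighted_increments _ _ (fine (W z))) => n;
  apply: le_trans (wz n); apply: ler_sum => k _;
  rewrite ler_pM2l ?exprn_gt0// dz sqr_normcE.
- by rewrite ReD ReN lerDl sqr_ge0.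
- by rewrite ImD ImN lerDr sqr_ge0.
Unshelve. all: by end_near. Qed.

End convergence.

(** * Completeness of L^2 and dominated convergence for multipliers *)

Section convergence_L2.
Context (R : realType).
Local Notation m := (circle_measure R).
Local Notation L2 := (L2 R).
Local Notation Linf := (Linf R).
Local Notation C := R[i].
Local Open Scope quotient_scope.
Local Notation N := (@cLp_norm _ _ _ m _ (lee1n 2)).

Lemma cvg_normc (x : nat -> C) (y : C) :
  Re (x n) @[n --> \oo] --> Re y -> Im (x n) @[n --> \oo] --> Im y ->
  normc (x n - y) @[n --> \oo] --> (0 : R).
Proof.
move=> xr xi.
have h : `|Re (x n) - Re y| + `|Im (x n) - Im y| @[n --> \oo] --> (0 : R).
  have dist0 (v : nat -> R) (l : R) : v n @[n --> \oo] --> l ->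
      `|v n - l| @[n --> \oo] --> (0 : R).
    move=> vl; rewrite -(@normr0 R R) -[X in `|X|](subrr l).
    by apply: cvg_norm; apply: cvgB => //; exact: cvg_cst.
  by rewrite -[X in _ --> X]addr0; apply: cvgD; exact: dist0.
apply: (squeeze_cvgr _ (cvg_cst 0) h); apply: nearW => n.
rewrite normc_ge0/= -ler_sqr ?nnegrE ?normc_ge0 ?addr_ge0//.
rewrite sqr_normcE ReD ReN ImD ImN -[(_ - _) ^+ 2]real_normK ?num_real//.
rewrite -[(Im _ - _) ^+ 2]real_normK ?num_real// sqrrD lerD2r lerDl.
by rewrite mulrn_wge0// mulr_ge0.
Qed.

Lemma limn_einf_le (v : (\bar R)^nat) (c : \bar R) :
  (forall n, v n <= c)%E -> (limn_einf v <= c)%E.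
Proof.
move=> vc; rewrite limn_einf_lim; apply: lime_le; first exact: is_cvg_einfs.
apply: nearW => n; apply: le_trans (vc n).
by apply: ereal_inf_lbound; exists n => /=.
Qed.

Lemma limn_einf_ge0 (v : (\bar R)^nat) :
  (forall n, 0 <= v n)%E -> (0 <= limn_einf v)%E.
Proof.
move=> v0; rewrite limn_einf_lim; apply: lime_ge; first exact: is_cvg_einfs.
by apply: nearW => n; apply: le_ereal_inf_tmp => _ [k _ <-].
Qed.

(** Completeness of L^2, in the form of Riesz and Fischer: the pointwise limit is a
limit in norm by the lemma of Fatou. Rapidly Cauchy sequences are all that the
projection theorem needs, as its minimizing sequences can be chosen so. *)
Lemma fast_cauchy_cvg (u : nat -> L2) :
  (forall n, N (u n.+1 - u n) <= 2^-1 ^+ n) ->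
  exists f, forall n, N (u n - f) <= 2 * 2^-1 ^+ n.
Proof.
move=> uc.
(* The upper limits are measurable with no condition on the points where the
   sequence diverges. *)
pose fr z := fine (limn_esup (fun n => (Re (repr (u n) z))%:E)).
pose fi z := fine (limn_esup (fun n => (Im (repr (u n) z))%:E)).
pose f z := Complex (fr z) (fi z).
have mRI k : measurable_fun setT (fun z => (Re (repr (u k) z))%:E) /\
             measurable_fun setT (fun z => (Im (repr (u k) z))%:E).
  by have [mr mi] := repr_cmeasurable (u k); split; exact/measurable_EFinP.
have mf : cmeasurable f.
  split.
    apply: (measurableT_comp (@fine_measurable R setT measurableT)).
    by apply: measurable_fun_limn_esup => n; have [] := mRI n.
  apply: (measurableT_comp (@fine_measurable R setT measurableT)).
  by apply: measurable_fun_limn_esup => n; have [] := mRI n.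
have cf : \forall z \ae m, forall n,
    normc (repr (u (n + k)%N - u n) z - (f z - repr (u n) z)) @[k --> \oo] --> (0 : R).
  have aeB : \forall z \ae m, forall k n,
      repr (u k - u n) z = repr (u k) z - repr (u n) z.
    apply: ae_foralln => k; apply: ae_foralln => n; near=> z.
    by rewrite (near (reprD (u k) (- u n)) z)// (near (reprN (u n)) z).
  apply: filterS2 (fast_cauchy_cvg_ae uc) aeB => z [cr ci] zB n.
  under eq_fun do rewrite zB opprB addrA subrK.
  have lim_fine (v : nat -> R) : cvgn v -> v k @[k --> \oo] --> fine (limn_esup (fun n => (v n)%:E)).
    move=> cv; have ev : (v k)%:E @[k --> \oo] --> (limn v)%:E.
      by apply: cvg_EFin => //; exact: nearW.
    by have [_ ->] := cvg_limn_einf_sup ev.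
  apply: (@cvg_comp _ _ _ (fun k => n + k)%N
    (fun k => normc (repr (u k) z - f z)) \oo \oo).
    by under eq_fun do rewrite addnC; exact: cvg_addnr.
  by apply: cvg_normc; exact: lim_fine.
have fB n : (\int[m]_z (normc (f z - repr (u n) z) ^+ 2)%:E <=
             ((2 * 2^-1 ^+ n) ^+ 2)%:E)%E.
  pose v k z := (normc (repr (u (n + k)%N - u n) z) ^+ 2)%:E.
  have mv k : measurable_fun setT (v k).
    by have /integrableP[] := cLfun2_integrable_sqr (repr_L2 (u (n + k)%N - u n)).
  have v0 k z : (0 <= v k z)%E by rewrite lee_fin sqr_ge0.
  apply: (@le_trans _ _ (\int[m]_z limn_einf (v^~ z))%E).
    apply: ae_ge0_le_integral => //.
    - by move=> z _; rewrite lee_fin sqr_ge0.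
    - apply/measurable_EFinP; apply: measurable_funX; apply: cmeasurable_normc.
      by apply: cmeasurableB => //; exact: repr_cmeasurable.
    - by move=> z _; exact: limn_einf_ge0.
    - apply: measurableT_comp => //; apply: measurable_fun_limn_esup => k.
      exact: measurableT_comp.
    - apply: filterS cf => z /(_ n) cz _.
      have vz : v k z @[k --> \oo] --> (normc (f z - repr (u n) z) ^+ 2)%:E.
        apply: cvg_EFin; first exact: nearW.
        have hc : normc (repr (u (n + k)%N - u n) z) @[k --> \oo] -->
            normc (f z - repr (u n) z).
          apply/cvgrPdist_le => e e0; have /cvgrPdist_le/(_ e e0) := cz.
          apply: filterS => k; rewrite sub0r normrN ger0_norm ?normc_ge0//.
          by apply: le_trans; rewrite [leRHS]normcB; exact: dist_normc.
        by apply: (@cvg_comp _ _ _ _ (fun x => x ^+ 2) _ _ _ hc); exact: exprn_continuous.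
      by have [-> _] := cvg_limn_einf_sup vz.
  apply: (le_trans (fatou m measurableT mv _)) => //.
  apply: limn_einf_le => k; rewrite integral_normc_sqr lee_fin.
  by rewrite ler_sqr ?nnegrE ?cLp_norm_ge0 ?mulr_ge0 ?exprn_ge0 ?invr_ge0//; exact: fast_cauchy_tail.
have fL : f \in cLfun_pred m 2%:E.
  rewrite (_ : f = 1 *: ((fun z => f z - repr (u 0%N) z) : circle R -> C) + repr (u 0%N)); last first.
    by apply/funext => z; rewrite scale1r -[RHS]/(f z - _ + _) subrK.
  apply: (cLfun_submod_closed m (lee1n 2)).2; last exact: repr_L2.
  apply: cLfun2_of_integral; last exact: le_lt_trans (fB 0%N) (ltry _).
  by apply: cmeasurableB => //; exact: repr_cmeasurable.
exists (toLp m (lee1n 2) f) => n; rewrite normBC; apply: le_norm.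
  by rewrite mulr_ge0 ?exprn_ge0 ?invr_ge0.
rewrite -lee_fin -integral_normc_sqr; apply: le_trans (fB n).
rewrite le_eqVlt; apply/orP; left; apply/eqP; apply: ae_eq_integral => //.
- by have /integrableP[] := cLfun2_integrable_sqr (repr_L2 (toLp m (lee1n 2) f - u n)).
- apply/measurable_EFinP; apply: measurable_funX; apply: cmeasurable_normc.
  by apply: cmeasurableB => //; exact: repr_cmeasurable.
- near=> z => _; rewrite (near (reprD (toLp m (lee1n 2) f) (- u n)) z)//.
  by rewrite (near (reprN (u n)) z)// (near (toLpK (lee1n 2) fL) z).
Unshelve. all: by end_near. Qed.

(** Dominated convergence for |h_n f|^2, with dominating function B^2 |f|^2. *)
Lemma bounded_cvg0 (h : nat -> Linf) (B : R) (f : L2) :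
  (forall n, \forall z \ae m, normc (repr (h n) z) <= B) ->
  (\forall z \ae m, normc (repr (h n) z) @[n --> \oo] --> (0 : R)) ->
  N (M_ (h n) f) @[n --> \oo] --> (0 : R).
Proof.
move=> hB h0.
have ae1 : \forall z \ae m, forall n, normc (repr (M_ (h n) f) z) ^+ 2 =
    normc (repr (h n) z) ^+ 2 * normc (repr f z) ^+ 2.
  by apply: ae_foralln => n; apply: filterS (reprM (h n) f) => z ->; rewrite normcM exprMn.
have ig : m.-integrable setT (EFin \o (fun z => B ^+ 2 * (normc (repr f z) ^+ 2))).
  by apply: integrable_scale; exact: cLfun2_integrable_sqr (repr_L2 f).
have [] := @dominated_convergence _ _ _ m setT measurableT
  (fun n z => (normc (repr (M_ (h n) f) z) ^+ 2)%:E) (cst 0%E)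
  (EFin \o (fun z => B ^+ 2 * (normc (repr f z) ^+ 2))).
- by move=> n; have /integrableP[] := cLfun2_integrable_sqr (repr_L2 (M_ (h n) f)).
- exact: measurable_cst.
- apply: filterS2 ae1 h0 => z az hz _.
  apply: cvg_EFin; first exact: nearW.
  rewrite (_ : _ \o _ = fun n => normc (repr (h n) z) ^+ 2 * normc (repr f z) ^+ 2); last first.
    by apply/funext => n /=.
  rewrite -(mul0r (normc (repr f z) ^+ 2)); apply: cvgM; last exact: cvg_cst.
  rewrite [X in _ --> X](_ : 0 = 0 ^+ 2); last by rewrite expr0n.
  by apply: (@cvg_comp _ _ _ _ (fun x => x ^+ 2) _ _ _ hz); exact: exprn_continuous.
- exact: ig.
- have hB' : \forall z \ae m, forall n, normc (repr (h n) z) <= B by exact: ae_foralln.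
  apply: filterS2 ae1 hB' => z az hz n _; rewrite /= lee_fin ger0_norm ?sqr_ge0//.
  by rewrite az ler_wpM2r ?sqr_ge0// ler_sqr ?nnegrE ?normc_ge0// (le_trans _ (hz n))// normc_ge0.
move=> _ _ /=; rewrite integral0.
under eq_fun do rewrite integral_normc_sqr.
move=> /fine_cvg /= sq0.
have : Num.sqrt (N (M_ (h n) f) ^+ 2) @[n --> \oo] --> Num.sqrt (0 : R).
  by apply: (@cvg_comp _ _ _ _ (@Num.sqrt R) _ _ _ sq0); exact: sqrt_continuous.
rewrite sqrtr0; under eq_fun do rewrite sqrtr_sqr ger0_norm ?cLp_norm_ge0//.
by [].
Qed.

Lemma bounded_cvg (g_ : nat -> Linf) (g : Linf) (B : R) (f : L2) :
  (forall n, \forall z \ae m, normc (repr (g_ n) z) <= B) ->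
  (\forall z \ae m, normc (repr (g_ n) z - repr g z) @[n --> \oo] --> (0 : R)) ->
  N (M_ (g_ n) f - M_ g f) @[n --> \oo] --> (0 : R).
Proof.
move=> gB gg; have [B' B'0 gB'] := Linf_bounded g.
have aeB : forall n, \forall z \ae m, repr (g_ n - g) z = repr (g_ n) z - repr g z.
  move=> n; near=> z.
  by rewrite (near (reprD (g_ n) (- g)) z)// (near (reprN g) z).
rewrite (_ : (fun n => _) = (fun n => N (M_ (g_ n - g) f))); last first.
  apply/funext => n; rewrite M_addl; congr (N (_ + _)).
  by rewrite -scaleN1r -[- g]scaleN1r; apply: cLp_ext; near=> z;
    rewrite (near (reprZ (-1) (M_ g f)) z)// (near (reprM (-1 *: g) f) z)//
      (near (reprZ (-1) g) z)// (near (reprM g f) z)// mulrA.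
apply: (@bounded_cvg0 _ (B + B')).
  move=> n; near=> z; rewrite (near (aeB n) z)// (le_trans (le_normcD _ _))// normcN.
  by apply: lerD; [exact: (near (gB n) z)|exact: (near gB' z)].
apply: filterS2 (ae_foralln aeB) gg => z az.
by under [in X in _ -> X]eq_fun do rewrite az.
Unshelve. all: by end_near. Qed.

End convergence_L2.

(** * Orthogonal projection onto closed subspaces *)

Section projection.
Context (R : realType).
Local Notation m := (circle_measure R).
Local Notation L2 := (L2 R).
Local Notation C := R[i].
Local Notation N := (@cLp_norm _ _ _ m _ (lee1n 2)).
Implicit Types (f g h : L2) (K : set L2).

Definition closed_subspace K :=
  [/\ K 0, (forall f g, K f -> K g -> K (f + g)),
      (forall (c : C) f, K f -> K (c *: f)) &
      forall (u : nat -> L2) f, (forall n, K (u n)) ->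
        N (u n - f) @[n --> \oo] --> (0 : R) -> K f].

Lemma cvg_pow_half : (2^-1 : R) ^+ n @[n --> \oo] --> (0 : R).
Proof. by apply: cvg_expr; rewrite ger0_norm// invf_lt1// ltr1n. Qed.

Lemma fast_cvg (u : nat -> L2) f : (forall n, N (u n - f) <= 2 * 2^-1 ^+ n) ->
  N (u n - f) @[n --> \oo] --> (0 : R).
Proof.
move=> uf; have h : 2 * 2^-1 ^+ n @[n --> \oo] --> (0 : R).
  by rewrite -(mulr0 2); apply: cvgM; [exact: cvg_cst|exact: cvg_pow_half].
apply: (squeeze_cvgr _ (cvg_cst 0) h); apply: nearW => n.
by rewrite cLp_norm_ge0 uf.
Qed.

Lemma norm_cvg (u : nat -> L2) f : N (u n - f) @[n --> \oo] --> (0 : R) ->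
  N (u n) @[n --> \oo] --> N f.
Proof.
move=> uf; apply/cvgrPdist_le => e e0; have /cvgrPdist_le/(_ e e0) := uf.
apply: filterS => n; rewrite sub0r normrN ger0_norm ?cLp_norm_ge0//; apply: le_trans.
have := normD (u n - f) f; have := normD (f - u n) (u n).
rewrite !subrK (normBC f) => h1 h2; rewrite ler_norml; apply/andP; split; lra.
Qed.

(** Otherwise moving f along h by the multiple <f, h> / (|h|^2 + 1) would shorten it;
the added 1 covers the case h = 0. *)
Lemma orthogonal_of_minimal f h :
  (forall c : C, N f ^+ 2 <= N (f - c *: h) ^+ 2) -> inner f h = 0.
Proof.
move=> fmin; set x := inner f h.
have H0 : 0 <= N h ^+ 2 by exact: sqr_ge0.
set t := (N h ^+ 2 + 1)^-1.
have t0 : 0 < t by rewrite invr_gt0 ltr_wpDl.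
have tH : t * (N h ^+ 2 + 1) = 1 by rewrite mulVf// gt_eqF// ltr_wpDl.
have := fmin (t%:C%C * x).
have fh : Re (inner f ((t%:C%C * x) *: h)) = t * normc x ^+ 2.
  rewrite innerZr conjcM conjc_real -/x -mulrA [conjc x * x]mulrC mul_conjc.
  by rewrite -realcM.
rewrite norm_sqrD normN normZ normcM normc_real (gtr0_norm t0) innerNr ReN fh !exprMn.
set X := normc x ^+ 2; set H := N h ^+ 2 => hmin.
have X0 : 0 <= X by exact: sqr_ge0.
have tX : t * X * (1 + t) <= 0.
  rewrite -/H in tH; have -> : t * X * (1 + t) = 2 * (t * X) - t * X * (t * H).
    by rewrite (_ : t * H = 1 - t); [ring|rewrite -tH; ring].
  move: hmin; rewrite expr2; lra.
have : X <= 0.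
  have : 0 < t * (1 + t) by rewrite mulr_gt0// addr_gt0.
  by move=> t1; rewrite -(pmulr_rle0 _ t1) mulrAC.
move=> X0'; apply: eq0_normc; apply/eqP; rewrite -sqrf_eq0 -/X.
by rewrite eq_le X0' X0.
Qed.

(** By the parallelogram identity, a sequence in K whose squared distances to f are
within 4^-n / 4 of the infimum is rapidly Cauchy; its limit is the nearest point
of K, and minimality is orthogonality. *)
Lemma projection_theorem K f : closed_subspace K ->
  exists g, K g /\ forall h, K h -> inner (f - g) h = 0.
Proof.
move=> [K0 KD KZ Kcl].
pose D := [set r : R | exists2 k, K k & r = N (f - k) ^+ 2].
have Dlb : has_lbound D by exists 0 => _ [k _ ->]; exact: sqr_ge0.
have hD : has_inf D by split => //; exists (N (f - 0) ^+ 2), 0.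
pose d := inf D.
have dmin k : K k -> d <= N (f - k) ^+ 2 by move=> Kk; apply: ge_inf => //; exists k.
pose e n : R := (2^-1 ^+ n) ^+ 2 / 4.
have e0 n : 0 < e n by rewrite /e divr_gt0// !exprn_gt0// invr_gt0.
have /choice[u uP] : forall n, exists k, K k /\ N (f - k) ^+ 2 < d + e n.
  by move=> n; have [_ [k Kk ->] kd] := inf_adherent (e0 n) hD; exists k.
have uc n : N (u n.+1 - u n) <= 2^-1 ^+ n.
  have [Kn un] := uP n; have [Kn1 un1] := uP n.+1.
  apply: le_norm; first by rewrite exprn_ge0// invr_ge0.
  have := parallelogram (f - u n) (f - u n.+1).
  rewrite (_ : f - u n - (f - u n.+1) = u n.+1 - u n); last first.
    by rewrite opprB addrC addrA subrK.
  rewrite (_ : f - u n + (f - u n.+1) =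
      (2 : C) *: (f - (2^-1 : C) *: (u n + u n.+1))); last first.
    rewrite scalerBr scalerA divff ?scale1r ?pnatr_eq0// scaler_nat (mulr2n f).
    by rewrite opprD addrACA.
  have := dmin _ (KZ (2^-1) _ (KD _ _ Kn Kn1)).
  rewrite normZ (_ : normc (2 : C) = 2); last first.
    by rewrite (_ : 2 = (2 : R)%:C%C) ?normc_real ?ger0_norm// rmorph_nat.
  have : e n.+1 <= e n.
    rewrite /e ler_pM2r ?invr_gt0// ler_sqr ?nnegrE ?exprn_ge0 ?invr_ge0//.
    by rewrite exprS ler_piMl ?exprn_ge0 ?invr_ge0// invf_le1// ler1n.
  move: un un1; rewrite (_ : (2^-1 ^+ n) ^+ 2 = 4 * e n); last by rewrite /e mulrC divfK.
  rewrite exprMn; lra.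
have [g gP] := fast_cauchy_cvg uc.
have ug := fast_cvg gP.
have Kg : K g by apply: (Kcl u) => // n; have [] := uP n.
have gd : N (f - g) ^+ 2 <= d.
  have h1 : N (f - u n) @[n --> \oo] --> N (f - g).
    apply: norm_cvg; rewrite (_ : (fun n => _) = (fun n => N (u n - g)))//.
    by apply/funext => n; rewrite opprB addrC addrA subrK normBC.
  have h2 : N (f - u n) ^+ 2 @[n --> \oo] --> N (f - g) ^+ 2.
    by apply: (@cvg_comp _ _ _ _ (fun x => x ^+ 2) _ _ _ h1); exact: exprn_continuous.
  have h3 : d + e n @[n --> \oo] --> d.
    rewrite -[X in _ --> X]addr0; apply: cvgD; first exact: cvg_cst.
    rewrite -(mul0r (4^-1)); apply: cvgM; last exact: cvg_cst.
    rewrite [X in _ --> X](_ : 0 = 0 ^+ 2); last by rewrite expr0n.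
    by apply: (@cvg_comp _ _ _ _ (fun x => x ^+ 2) _ _ _ cvg_pow_half); exact: exprn_continuous.
  by apply: (ler_cvg_to h2 h3); apply: nearW => n; have [_ /ltW] := uP n.
exists g; split=> // h Kh; apply: orthogonal_of_minimal => c.
by rewrite (le_trans gd)// -addrA -opprD; apply: dmin; apply: KD => //; exact: KZ.
Qed.

End projection.

(** * The Hardy space and its multipliers *)

Section hardy_space.
Context (R : realType).
Local Notation m := (circle_measure R).
Local Notation L2 := (L2 R).
Local Notation Linf := (Linf R).
Local Notation C := R[i].
Local Open Scope quotient_scope.
Local Notation N := (@cLp_norm _ _ _ m _ (lee1n 2)).
Implicit Types (f g h : L2) (a b : Linf) (c : C).

Lemma inner_cvg0 (u : nat -> L2) f g : (forall n, inner (u n) g = 0) ->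
  N (u n - f) @[n --> \oo] --> (0 : R) -> inner f g = 0.
Proof.
move=> ug uf; apply: eq0_normc; apply/eqP; rewrite eq_le normc_ge0 andbT.
have h : N (u n - f) * N g @[n --> \oo] --> (0 : R).
  by rewrite -(mul0r (N g)); apply: cvgM => //; exact: cvg_cst.
apply: (ler_cvg_to (cvg_cst _) h); apply: nearW => n.
apply: le_trans (cauchy_schwarz _ _).
by rewrite innerBl ug sub0r normcN.
Qed.

Lemma fourier_M_zpow k f n : fourier (M_ (zpow R k) f) n = fourier f (n - k).
Proof. by rewrite /fourier inner_Ml M_conj_zpow M_zpow_toL2 addrC. Qed.

Lemma closed_subspace_hardy : closed_subspace (@hardy R).
Proof.
split=> [n n0|f g hf hg n n0|c f hf n n0|u f hu uf n n0].
- exact: inner0l.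
- by rewrite /fourier innerDl [inner f _]hf// [inner g _]hg// addr0.
- by rewrite /fourier innerZl [inner f _]hf// mulr0.
- by apply: (inner_cvg0 _ uf) => k; exact: hu.
Qed.

Lemma hardy0 : hardy (0 : L2).
Proof. by have [] := closed_subspace_hardy. Qed.

Lemma hardyD f g : hardy f -> hardy g -> hardy (f + g).
Proof. by have [_ h _ _] := closed_subspace_hardy; exact: h. Qed.

Lemma hardyZ c f : hardy f -> hardy (c *: f).
Proof. by have [_ _ h _] := closed_subspace_hardy; exact: h. Qed.

Lemma hardyB f g : hardy f -> hardy g -> hardy (f - g).
Proof. by move=> hf hg; rewrite -scaleN1r; apply: hardyD => //; exact: hardyZ. Qed.

Lemma M_Zl c a f : M_ (c *: a) f = c *: M_ a f.
Proof.
apply: cLp_ext; near=> z.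
rewrite (near (reprM (c *: a) f) z)// (near (reprZ c a) z)//.
by rewrite (near (reprZ c (M_ a f)) z)// (near (reprM a f) z)// mulrA.
Unshelve. all: by end_near. Qed.

Lemma M_Nl a f : M_ (- a) f = - M_ a f.
Proof. by rewrite -scaleN1r M_Zl scaleN1r. Qed.

Lemma M_0l f : M_ (0 : Linf) f = 0.
Proof. by rewrite -(scale0r (0 : Linf)) M_Zl scale0r. Qed.

(** The functions a such that M_a preserves the Hardy space: these are the bounded
analytic functions, but stability under multiplication is what the projection
onto the model space uses. *)
Definition hardy_multiplier a := forall f, hardy f -> hardy (M_ a f).

Lemma hardy_multiplier_zpow (k : nat) : hardy_multiplier (zpow R k).
Proof. by move=> f hf n n0; rewrite fourier_M_zpow hf// subr_lt0 (lt_le_trans n0). Qed.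

Lemma hardy_multiplier_poly (c : nat -> C) n :
  hardy_multiplier (\sum_(0 <= k < n) c k *: zpow R k).
Proof.
move=> f hf; elim: n => [|n ih]; first by rewrite big_nil M_0l; exact: hardy0.
rewrite big_nat_recr//= M_addl M_Zl; apply: hardyD => //; apply: hardyZ.
exact: hardy_multiplier_zpow.
Qed.

Lemma repr_poly (c : nat -> C) n :
  \forall z \ae m, repr (\sum_(0 <= k < n) c k *: zpow R k) z =
                   \sum_(0 <= k < n) c k * (z : C) ^+ k.
Proof.
elim: n => [|n ih].
  by rewrite big_nil; apply: filterS (repr0 m (leey 1%E)) => z ->; rewrite big_nil.
rewrite big_nat_recr//=; near=> z; rewrite big_nat_recr//=.
rewrite (near (reprD (\sum_(0 <= k < n) c k *: zpow R k) (c n *: zpow R n)) z)//.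
rewrite (near (reprZ (c n) (zpow R n)) z)// (near (repr_zpow R n) z)//.
by rewrite (near ih z).
Unshelve. all: by end_near. Qed.

Lemma hardy_multiplier_cvg (g_ : nat -> Linf) (g : Linf) (B : R) :
  (forall n, hardy_multiplier (g_ n)) ->
  (forall n, \forall z \ae m, normc (repr (g_ n) z) <= B) ->
  (\forall z \ae m, normc (repr (g_ n) z - repr g z) @[n --> \oo] --> (0 : R)) ->
  hardy_multiplier g.
Proof.
move=> gm gB gg f hf; have [_ _ _ hcl] := closed_subspace_hardy.
by apply: (hcl (fun n => M_ (g_ n) f)) => [n|]; [exact: gm|exact: bounded_cvg gg].
Qed.

Lemma cvg_complex_normc {T : Type} (G : set_system T) {FG : Filter G}
    (x : T -> C) (y : C) : (x t : C^o) @[t --> G] --> (y : C^o) ->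
  normc (x t - y) @[t --> G] --> (0 : R).
Proof.
move=> /cvgrPdist_lt xy; apply/cvgrPdist_lt => e e0.
have e0' : 0 < e%:C%C :> C by rewrite ltcR.
apply: filterS (xy _ e0') => t.
by rewrite normc_def -sqr_normcE sqrtr_sqr sub0r normrN ger0_norm ?normc_ge0// normcB ltcR
  ger0_norm ?normc_ge0.
Qed.

Lemma cvg_normc_ReIm (x : nat -> C) (y : C) :
  normc (x n - y) @[n --> \oo] --> (0 : R) ->
  (Re (x n) @[n --> \oo] --> Re y) /\ (Im (x n) @[n --> \oo] --> Im y).
Proof.
move=> xy; split; apply/cvgrPdist_le => e e0; have /cvgrPdist_le/(_ e e0) := xy;
  apply: filterS => n; rewrite sub0r normrN ger0_norm ?normc_ge0//;
  apply: le_trans; rewrite normcB.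
- by rewrite -ReN -ReD normRe.
- by rewrite -ImN -ImD normIm.
Qed.

Lemma cmeasurable_cvg (g_ : nat -> circle R -> C) (g : circle R -> C) :
  (forall n, cmeasurable (g_ n)) ->
  (forall z, normc (g_ n z - g z) @[n --> \oo] --> (0 : R)) -> cmeasurable g.
Proof.
move=> mg gg; split.
- apply: (@measurable_fun_cvg _ _ _ setT (fun n => @Re R \o g_ n)) => [n|z _].
    by have [] := mg n.
  by have [] := cvg_normc_ReIm (gg z).
- apply: (@measurable_fun_cvg _ _ _ setT (fun n => @Im R \o g_ n)) => [n|z _].
    by have [] := mg n.
  by have [] := cvg_normc_ReIm (gg z).
Qed.

Lemma cmeasurable_poly (c : nat -> C) n :
  cmeasurable (fun z : circle R => \sum_(0 <= k < n) c k * (z : C) ^+ k).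
Proof.
elim: n => [|n ih].
  rewrite (_ : (fun _ => _) = cst 0); first exact: cmeasurable_cst.
  by apply/funext => z; rewrite big_nil.
rewrite (_ : (fun _ => _) = (fun z : circle R => \sum_(0 <= k < n) c k * (z : C) ^+ k)
   \+ (cst (c n) \* (fun z : circle R => (z : C) ^ n))); last first.
  by apply/funext => z; rewrite big_nat_recr.
apply: cmeasurableD => //; apply: cmeasurableM; first exact: cmeasurable_cst.
by have /cLfun_predP[] := circle_exp_subproof R n.
Qed.

(** Comparison with a geometric series of ratio t / s: the terms of a convergent
series are bounded. *)
Lemma power_series_bounded (c : nat -> C) (s t : R) (y : C) : 0 < t < s ->
  (series (fun n => c n * (s%:C%C) ^+ n : C^o) @ \oo --> (y : C^o)) ->
  exists B : R, forall n, \sum_(0 <= k < n) normc (c k) * t ^+ k <= B.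
Proof.
move=> /andP[t0 ts] cs; have s0 := lt_trans t0 ts.
have [B Bc] : exists B : R, forall k, normc (c k) * s ^+ k <= B.
  have ccs : cvgn (series (fun n => c n * (s%:C%C) ^+ n : C^o)).
    by apply/cvg_ex; exists y.
  have /(@cvg_complex_normc nat \oo _ (fun n => c n * (s%:C%C) ^+ n)) c0 :=
    cvg_series_cvg_0 ccs.
  have : cvgn (fun n => normc (c n * s%:C%C ^+ n - 0)) by apply/cvg_ex; exists 0.
  move=> /cvg_seq_bounded/bounded_fun_has_ubound[B hB]; exists B => k.
  have := hB (normc (c k) * s ^+ k); apply; exists k => //=.
  by rewrite subr0 normcM normcX normc_real gtr0_norm.
exists (B * (1 - t / s)^-1) => n.
have B0 : 0 <= B by rewrite (le_trans _ (Bc 0%N))// mulr_ge0 ?normc_ge0.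
have q0 : 0 < t / s by rewrite divr_gt0.
apply: (@le_trans _ _ (series (geometric B (t / s)) n)).
  apply: ler_sum => k _; rewrite /= expr_div_n mulrA ler_pdivlMr ?exprn_gt0//.
  by rewrite mulrAC ler_pM2r ?exprn_gt0.
by apply: geometric_le_lim => //; rewrite gtr0_norm// ltr_pdivrMr// mul1r.
Qed.

(** The polynomials approximating F (t z) are bounded on the circle uniformly in
their degree, because the power series of F still converges at the point
(t + 1) / 2 beyond t. *)
Lemma hardy_multiplier_dilation (F : C -> C) (t : R) : 0 < t < 1 ->
  analytic_on (@unit_disk R) F -> bounded_on (@unit_disk R) F ->
  let Ft z := F (t%:C%C * circle_val z) in
  Ft \in cLfun_pred m +oo%E /\ hardy_multiplier (toLp m (leey 1%E) Ft).
Proof.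
move=> /andP[t0 t1] anF [M FM] Ft.
have [] := anF 0 1 ltr01; first by move=> w; rewrite /= subr0.
move=> c cF.
have cFw w : normc w < 1 ->
    normc (\sum_(0 <= k < n) c k * w ^+ k - F w) @[n --> \oo] --> (0 : R).
  move=> w1; apply: (@cvg_complex_normc nat \oo _ (fun n => \sum_(0 <= k < n) c k * w ^+ k)).
  by have := cF w; rewrite subr0 => /(_ w1).
have tz (z : circle R) : normc (t%:C%C * (z : C)) < 1.
  by rewrite normcM normc_circle mulr1 normc_real gtr0_norm.
pose d k := c k * t%:C%C ^+ k.
have polyE n (z : circle R) : \sum_(0 <= k < n) d k * (z : C) ^+ k =
    \sum_(0 <= k < n) c k * (t%:C%C * (z : C)) ^+ k.
  by apply: eq_bigr => k _; rewrite exprMn mulrA.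
have cvgF (z : circle R) :
    normc (\sum_(0 <= k < n) d k * (z : C) ^+ k - Ft z) @[n --> \oo] --> (0 : R).
  by under eq_fun do rewrite polyE; exact: cFw.
have mF : cmeasurable Ft by apply: cmeasurable_cvg cvgF => n; exact: cmeasurable_poly.
have FtL : Ft \in cLfun_pred m +oo%E.
  by apply: (@bounded_cLfun _ _ _ _ _ M) => //; apply: aeW => z; apply: FM; exact: tz.
split=> //.
have [B dB] : exists B : R, forall n, \sum_(0 <= k < n) normc (d k) <= B.
  pose s := (t + 1) / 2.
  have s1 : normc (s%:C%C) < 1 by rewrite normc_real gtr0_norm /s; lra.
  have := cF s%:C%C; rewrite subr0 => /(_ s1) /power_series_bounded => /(_ t).
  move=> [|B hB]; first by rewrite /s; apply/andP; split; lra.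
  exists B => n; apply: le_trans (hB n); apply: ler_sum => k _.
  by rewrite normcM normcX normc_real (gtr0_norm t0).
apply: (@hardy_multiplier_cvg (fun n => \sum_(0 <= k < n) d k *: zpow R k) _ B).
- by move=> n; exact: hardy_multiplier_poly.
- move=> n; apply: filterS (repr_poly d n) => z ->; apply: le_trans (dB n).
  apply: (le_trans (normc_sum _ _)); apply: ler_sum => k _.
  by rewrite normcM normcX normc_circle expr1n mulr1.
- apply: filterS2 (ae_foralln (repr_poly d)) (toLpK (leey 1%E) FtL) => z dz Fz.
  by under eq_fun do rewrite dz Fz; exact: cvgF.
Qed.

(** The dilations by t = 1 - 2^-(n + 1) share the bound of F and converge almost
everywhere to the boundary function. *)
Lemma inner_function_hardy_multiplier (F : C -> C) a :
  inner_function F a -> hardy_multiplier a.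
Proof.
move=> [anF bF radF _]; have [M FM] := bF.
pose t n : R := 1 - (2^-1) ^+ n.+1.
have t01 n : 0 < t n < 1.
  have h1 : 0 < (2^-1 : R) ^+ n.+1 by rewrite exprn_gt0 ?invr_gt0.
  have h2 : (2^-1 : R) ^+ n.+1 < 1 by rewrite exprn_ilt1 ?invr_ge0 ?invf_lt1 ?ltr1n.
  by rewrite /t; lra.
have tcvg : t n @[n --> \oo] --> (1 : R).
  rewrite -[X in _ --> X]subr0; apply: cvgB; first exact: cvg_cst.
  apply: (squeeze_cvgr _ (cvg_cst 0) (@cvg_pow_half R)); apply: nearW => n.
  by rewrite exprn_ge0 ?invr_ge0//= exprS ler_piMl ?exprn_ge0 ?invr_ge0// invf_le1// ler1n.
pose Ft n z := F ((t n)%:C%C * circle_val z).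
have FtP n := hardy_multiplier_dilation (t01 n) anF bF.
apply: (@hardy_multiplier_cvg (fun n => toLp m (leey 1%E) (Ft n)) _ M).
- by move=> n; have [] := FtP n.
- move=> n; have [FL _] := FtP n; apply: filterS (toLpK (leey 1%E) FL) => z ->.
  apply: FM; have /andP[h0 h1] := t01 n.
  suff : normc ((t n)%:C%C * (z : C)) < 1 by [].
  by rewrite normcM normc_circle mulr1 normc_real gtr0_norm.
- have aeF : \forall z \ae m, forall n, repr (toLp m (leey 1%E) (Ft n)) z = Ft n z.
    by apply: ae_foralln => n; apply: toLpK; have [] := FtP n.
  apply: filterS2 aeF radF => z Fz radz.
  under eq_fun do rewrite Fz.
  have radz' : normc (F (t%:C%C * circle_val z) - repr a z) @[t --> (1 : R)^'-] --> (0 : R).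
    exact: (@cvg_complex_normc _ _ _ (fun t => F (t%:C%C * circle_val z)) _ radz).
  have := (cvg_at_leftP _ _ _).1 radz'.
  by apply; split => // n; have /andP[] := t01 n.
Qed.

End hardy_space.

(** * Integrals of powers of the coordinate *)

Section circle_integral.
Context (R : realType).
Local Notation m := (circle_measure R).
Local Notation L2 := (L2 R).
Local Notation C := R[i].
Local Notation N := (@cLp_norm _ _ _ m _ (lee1n 2)).

(** The function g is shifted by 1 to be nonnegative, which is the case where
integrals against the uniform law on [0, 2 pi] reduce to Lebesgue integrals. *)
Lemma circle_integral_FTC (g : circle R -> R) (G g' : R -> R) :
  measurable_fun setT g -> (forall z, `|g z| <= 1) ->
  (forall t, g (expi t) = g' t) -> continuous g' ->
  (forall t : R, is_derive t (1 : R) G (g' t)) -> G (2 * trigo.pi) = G 0 ->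
  \int[m]_z g z = 0.
Proof.
move=> mg gB gg' cg' dG G2pi.
have g1 z : -1 <= g z by have := gB z; rewrite ler_norml => /andP[].
have ig : m.-integrable setT (EFin \o g).
  apply: (@le_integrable _ _ _ m setT measurableT _ (cst 1%:E)).
  - exact/measurable_EFinP.
  - by move=> z _; rewrite /= lee_fin normr1.
  - exact: finite_measure_integrable_cst.
have pi0 := twopi_gt0 R.
have h1 : (\int[m]_z (g z + 1)%:E = 1)%E.
  rewrite ge0_integral_distribution//; last 2 first.
    by apply/measurable_EFinP; apply: measurable_funD => //; exact: measurable_cst.
    by move=> z; rewrite lee_fin -lerBlDr sub0r.
  rewrite integral_uniform; last 2 first.
    apply/measurable_EFinP; apply: measurable_funD; last exact: measurable_cst.
    by apply: measurableT_comp => //; exact: measurable_expi.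
    by move=> t; rewrite lee_fin -lerBlDr sub0r.
  under eq_integral do rewrite /= gg'.
  rewrite (@continuous_FTC2 _ (fun t => g' t + 1) (fun t => G t + t))//.
  - rewrite G2pi addr0 subr0 -EFinB -EFinM.
    by congr EFin; rewrite addrAC subrr add0r mulVf// gt_eqF.
  - apply: continuous_subspaceT => t; apply: cvgD; first exact: cg'.
    exact: cvg_cst.
  - have dF (t : R) : is_derive t (1 : R) (fun t : R => G t + t) (g' t + 1) by exact: is_deriveD.
    have cF : continuous (fun t : R => G t + t).
      move=> t; apply/differentiable_continuous/derivable1_diffP.
      by have [] := dF t.
    split.
    + by move=> t _; have [] := dF t.
    + exact/cvg_at_right_filter/cF.
    + exact/cvg_at_left_filter/cF.
  - move=> t _; rewrite derive1E.
    have dF : is_derive t (1 : R) (fun t : R => G t + t) (g' t + 1) by exact: is_deriveD.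
    by rewrite derive_val.
have : (\int[m]_z (g z + 1)%:E = \int[m]_z (g z)%:E + 1%:E)%E.
  rewrite (_ : 1%:E = \int[m]_z cst 1%:E z)%E; last first.
    by rewrite integral_cst// mul1e; exact/esym/probability_setT.
  by rewrite -integralD//; exact: finite_measure_integrable_cst.
rewrite h1 /Rintegral; have := integrable_fin_num measurableT ig.
rewrite /comp /=; case: (integral _ _ _) => // r _ /= [].
by lra.
Qed.

Lemma expi_pow (t : R) (k : nat) :
  ((expi t : circle R) : C) ^+ k = Complex (cos (k%:R * t)) (sin (k%:R * t)).
Proof.
elim: k => [|k ih]; first by rewrite mul0r cos0 sin0.
rewrite exprS ih -natr1 mulrDl mul1r cosD sinD; apply: complex_ext.
  by rewrite ReM /=; ring.
by rewrite ImM /=; ring.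
Qed.

Lemma cos_sin_2pi_nat (k : nat) :
  cos (k%:R * (2 * trigo.pi)) = 1 :> R /\ sin (k%:R * (2 * trigo.pi)) = 0 :> R.
Proof.
rewrite (mulr_natl (2 * trigo.pi)) (mulr_natl trigo.pi) -[X in cos X]add0r -[X in sin X]add0r.
by rewrite (periodicn (@cosD2pi R)) (periodicn (@sinD2pi R)) cos0 sin0.
Qed.

(** This orthogonality is what puts the constant function 1 in the Hardy space. *)
Lemma cintegral_circle_pow (k : nat) :
  cintegral (fun z : circle R => (z : C) ^+ k.+1) = 0.
Proof.
have k0 : k.+1%:R != 0 :> R by rewrite pnatr_eq0.
have [mr mi] : cmeasurable (fun z : circle R => (z : C) ^+ k.+1).
  by have /cLfun_predP[] := circle_exp_subproof R k.+1.
have lin (t : R) : is_derive t (1 : R) (fun x => k.+1%:R * x) k.+1%:R.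
  rewrite -[X in is_derive _ _ _ X]mulr1.
  exact: is_deriveZ.
have cont (h : R -> R) : continuous h -> continuous (fun t : R => h (k.+1%:R * t)).
  move=> ch t; apply: continuous_comp; last exact: ch.
  exact: mulrl_continuous.
have norm1 (z : circle R) : normc ((z : C) ^+ k.+1) = 1.
  by rewrite normcX normc_circle expr1n.
apply: complex_ext; rewrite /cintegral /=.
- apply: (@circle_integral_FTC _ (fun t => k.+1%:R^-1 * sin (k.+1%:R * t))
    (fun t => cos (k.+1%:R * t))) => //.
  + by move=> z; rewrite -[leRHS](norm1 z) normRe.
  + by move=> t; rewrite expi_pow.
  + exact/cont/continuous_cos.
  + move=> t; rewrite -[X in is_derive _ _ _ X](mulKf k0) [_ * cos _]mulrC.
    exact: is_deriveZ.
  + by rewrite mulr0 sin0 (cos_sin_2pi_nat k.+1).2.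
- apply: (@circle_integral_FTC _ (fun t => - k.+1%:R^-1 * cos (k.+1%:R * t))
    (fun t => sin (k.+1%:R * t))) => //.
  + by move=> z; rewrite -[leRHS](norm1 z) normIm.
  + by move=> t; rewrite expi_pow.
  + exact/cont/continuous_sin.
  + move=> t; apply: is_derive_eq.
    by rewrite /GRing.scale /=; field.
  + by rewrite mulr0 cos0 (cos_sin_2pi_nat k.+1).1.
Qed.

End circle_integral.

(** * The projection onto the model space and its commutator with the shift *)

Section projections.
Context (R : realType).
Local Notation m := (circle_measure R).
Local Notation L2 := (L2 R).
Local Notation Linf := (Linf R).
Local Notation C := R[i].
Local Open Scope quotient_scope.
Local Notation N := (@cLp_norm _ _ _ m _ (lee1n 2)).
Local Notation one := (toL2 (zpow R 0)).
Local Notation Mz := (M_ (zpow R 1)).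
Implicit Types (f g h : L2) (a b theta : Linf) (c : C) (K : set L2).

Lemma M_zpowVK n f : M_ (zpow R n) (M_ (zpow R (- n)) f) = f.
Proof. by rewrite -{1}(opprK n) M_zpowK. Qed.

Lemma repr_one : \forall z \ae m, repr one z = 1.
Proof. by apply: filterS2 (repr_toL2 (zpow R 0)) (repr_zpow R 0) => z -> ->. Qed.

Lemma norm_one : N one = 1.
Proof.
apply/eqP; rewrite -(@eqrXn2 _ 2)// ?cLp_norm_ge0// expr1n; apply/eqP/complexI.
rewrite -innerE (@inner_ae _ one one (cst 1)).
- have m1 : (\int[m]_z cst 1%:E z = 1)%E.
    by rewrite integral_cst// mul1e; exact: probability_setT.
  by rewrite /cintegral /Rintegral /= integral0 m1.
- exact: cmeasurable_cst.
- by apply: filterS repr_one => z ->; rewrite conjc1 mulr1.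
Qed.

Lemma hardy_one : hardy one.
Proof.
move=> n n0; have [k ->] : exists k : nat, n = - (k.+1)%:Z.
  by case: n n0 => // k _; exists k; rewrite NegzE.
rewrite -(cintegral_circle_pow R k); apply: inner_ae.
  by have /cLfun_predP[] := circle_exp_subproof R k.+1.
near=> z; rewrite (near repr_one z)// mul1r.
rewrite (near (repr_toL2 (zpow R (- (k.+1)%:Z))) z)//.
by rewrite (near (repr_zpow R (- (k.+1)%:Z)) z)// conj_circle_expz opprK.
Unshelve. all: by end_near. Qed.

Lemma orth_proj_eq K f g : (forall u v, K u -> K v -> K (u - v)) ->
  K g -> (forall h, K h -> inner (f - g) h = 0) -> orth_proj K f = g.
Proof.
move=> KB Kg fg; rewrite /orth_proj.
case: xgetP => [k _ [Kk fk]|/(_ g)]; last by move=> h; exfalso; apply: h.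
apply/eqP; rewrite -subr_eq0; apply/eqP/cLp_norm_eq0.
have kg := KB _ _ Kk Kg.
apply/eqP; rewrite -sqrf_eq0 norm_inner.
have {1}-> : k - g = (f - g) - (f - k) by rewrite opprB [RHS]addrC addrA subrK.
by rewrite innerBl fk// fg// subr0.
Qed.

Local Notation Pp := (orth_proj (@hardy R)).

Lemma riesz_projP f : hardy (Pp f) /\ forall h, hardy h -> inner (f - Pp f) h = 0.
Proof.
have [g [hg fg]] := projection_theorem f (closed_subspace_hardy R).
by rewrite (orth_proj_eq _ hg fg)//; exact: hardyB.
Qed.

Lemma riesz_proj_hardy f : hardy (Pp f).
Proof. by have [] := riesz_projP f. Qed.

Lemma riesz_proj_orth f h : hardy h -> inner (f - Pp f) h = 0.
Proof. by have [_] := riesz_projP f; exact. Qed.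

Lemma riesz_proj_eq f g : hardy g -> (forall h, hardy h -> inner (f - g) h = 0) ->
  Pp f = g.
Proof. by apply: orth_proj_eq; exact: hardyB. Qed.

Lemma riesz_projZD c f g : Pp (c *: f + g) = c *: Pp f + Pp g.
Proof.
apply: riesz_proj_eq => [|h hh].
  by apply: hardyD; [apply: hardyZ|]; exact: riesz_proj_hardy.
rewrite opprD addrACA -scalerBr innerDl innerZl.
by rewrite !riesz_proj_orth// mulr0 addr0.
Qed.

Lemma riesz_proj_norm f : N (Pp f) <= N f.
Proof.
apply: le_norm; first exact: cLp_norm_ge0.
have -> : N f ^+ 2 = N (f - Pp f) ^+ 2 + N (Pp f) ^+ 2.
  rewrite -{1}(subrK (Pp f) f) (norm_sqrD (f - Pp f)) riesz_proj_orth; last exact: riesz_proj_hardy.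
  by rewrite mulr0 addr0.
by rewrite lerDr sqr_ge0.
Qed.

(** With k = f - P+ f orthogonal to H^2 and c the coefficient of index -1 of k, the
function z k - c is orthogonal to H^2: a function u of H^2 is u_0 + z u' with u'
in H^2, <z k, z u'> = <k, u'> = 0, and the constant parts cancel. *)
Lemma riesz_proj_shift f :
  Pp (Mz f) = Mz (Pp f) + inner f (toL2 (zpow R (-1))) *: one.
Proof.
set k := f - Pp f; set c := inner f _.
have kc : inner k (toL2 (zpow R (-1))) = c.
  by rewrite innerBl [X in _ - X](riesz_proj_hardy f)// subr0.
have inner_one : inner one one = 1 by rewrite innerE norm_one expr1n.
have zk_one : inner (Mz k) one = c.
  by rewrite inner_Ml M_conj_zpow M_zpow_toL2 addr0.
apply: riesz_proj_eq => [|u hu].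
  apply: hardyD; last exact/hardyZ/hardy_one.
  by apply: (hardy_multiplier_zpow 1); exact: riesz_proj_hardy.
rewrite opprD addrA -M_B -/k innerBl innerZl.
set u0 := fourier u 0; set u' := M_ (zpow R (-1)) (u - u0 *: one).
have hv : hardy (u - u0 *: one) by apply: hardyB => //; apply: hardyZ; exact: hardy_one.
have uE : u = u0 *: one + Mz u'.
  by rewrite /u' M_zpowVK addrC subrK.
have v0 : inner (u - u0 *: one) one = 0.
  by rewrite innerBl innerZl inner_one mulr1 subrr.
have hu' : hardy u'.
  move=> n n0; rewrite fourier_M_zpow opprK.
  have : n + 1 <= 0 by rewrite lezD1.
  rewrite le_eqVlt => /predU1P[->|]; first exact: v0.
  exact: hv.
rewrite uE !innerDr !innerZr zk_one inner_one mulr1.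
have -> : inner (Mz k) (Mz u') = 0.
  by rewrite inner_Ml M_conj_zpow M_zpowK riesz_proj_orth.
have -> : inner one (Mz u') = 0.
  by rewrite -[Mz u'](addKr (u0 *: one)) -uE addrC inner_conj v0 conjc0.
by rewrite !addr0 mulrC subrr.
Qed.

(** The range of M_theta P+ M_(conj theta) is theta H^2, which is removed from H^2. *)
Definition model_proj theta f := Pp f - M_ theta (Pp (M_ (Linf_conj theta) f)).

Section inner_symbol.
Variable theta : Linf.
Hypothesis theta_H : hardy_multiplier theta.
Hypothesis theta_1 : unimodular theta.

Lemma model_space_sub f g : model_space theta f -> model_space theta g ->
  model_space theta (f - g).
Proof.
move=> [hf ff] [hg gg]; split; first exact: hardyB.
by move=> h hh; rewrite innerBl ff// gg// subrr.
Qed.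

Lemma orth_proj_model f : orth_proj (model_space theta) f = model_proj theta f.
Proof.
apply: orth_proj_eq; first exact: model_space_sub.
  split.
    by apply: hardyB; [|apply: theta_H]; exact: riesz_proj_hardy.
  move=> _ [h hh <-]; rewrite innerBl.
  have -> : inner (Pp f) (M_ theta h) = inner f (M_ theta h).
    apply/eqP; rewrite eq_sym -subr_eq0 -innerBl; apply/eqP/riesz_proj_orth.
    exact: theta_H.
  rewrite !inner_Mr unimodular_conjK//.
  by rewrite -innerBl riesz_proj_orth.
move=> k [hk kth]; rewrite opprB addrCA addrC innerDl riesz_proj_orth// add0r.
rewrite inner_conj kth ?conjc0//; exists (Pp (M_ (Linf_conj theta) f)) => //.
exact: riesz_proj_hardy.
Qed.

Lemma model_projZD c f g :
  model_proj theta (c *: f + g) = c *: model_proj theta f + model_proj theta g.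
Proof.
rewrite /model_proj M_D M_Z !riesz_projZD M_D M_Z scalerBr.
by rewrite opprD addrACA.
Qed.

Lemma model_proj_bounded :
  exists2 B : R, 0 <= B & forall f, N (model_proj theta f) <= B * N f.
Proof.
have [B B0 hB] := M_bounded theta; have [B' B'0 hB'] := M_bounded (Linf_conj theta).
exists (1 + B * B') => [|f]; first by rewrite addr_ge0 ?mulr_ge0.
rewrite /model_proj (le_trans (normD _ _))// normN mulrDl mul1r.
apply: lerD; first exact: riesz_proj_norm.
rewrite (le_trans (hB _))// -mulrA ler_wpM2l//.
by rewrite (le_trans (riesz_proj_norm _)).
Qed.

(** The commutator of P+ with the shift, minus its conjugate by M_theta. *)
Lemma model_proj_shift f : model_proj theta (Mz f) - Mz (model_proj theta f) =
  inner f (toL2 (zpow R (-1))) *: one -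
  inner f (M_ theta (toL2 (zpow R (-1)))) *: toL2 theta.
Proof.
rewrite /model_proj (M_comm (Linf_conj theta)) !riesz_proj_shift M_B M_D M_Z M_toL2.
rewrite (M_comm theta (zpow R 1)) inner_Mr.
by rewrite [- (_ + _)]opprD addrACA [LHS]addrAC subrr add0r.
Qed.

End inner_symbol.
End projections.

(** * The algebra of functions commuting with a bounded operator *)

Section commutant.
Context (R : realType).
Local Notation m := (circle_measure R).
Local Notation L2 := (L2 R).
Local Notation Linf := (Linf R).
Local Notation C := R[i].
Local Open Scope quotient_scope.
Local Notation N := (@cLp_norm _ _ _ m _ (lee1n 2)).
Local Notation one := (toL2 (zpow R 0)).
Implicit Types (f : L2) (a b : Linf) (c : C).

Variable Y : L2 -> L2.
Hypothesis Y_linear : linear Y.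
Variable B : R.
Hypothesis Y_bounded : forall f, N (Y f) <= B * N f.

Let Y_D f1 f2 : Y (f1 + f2) = Y f1 + Y f2.
Proof. by rewrite -[f1]scale1r Y_linear !scale1r. Qed.

Let Y_Z c f : Y (c *: f) = c *: Y f.
Proof.
have Y0 : Y 0 = 0 by apply: (addIr (Y 0)); rewrite -Y_D !add0r.
by rewrite -[c *: f]addr0 Y_linear Y0 addr0.
Qed.

Let Y_B f1 f2 : Y (f1 - f2) = Y f1 - Y f2.
Proof. by rewrite Y_D -scaleN1r Y_Z scaleN1r. Qed.

Definition commutes a := forall f, Y (M_ a f) = M_ a (Y f).

Lemma commutesD a b : commutes a -> commutes b -> commutes (a + b).
Proof. by move=> ha hb f; rewrite !M_addl Y_D ha hb. Qed.

Lemma commutesZ c a : commutes a -> commutes (c *: a).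
Proof. by move=> ha f; rewrite !M_Zl Y_Z ha. Qed.

Lemma commutesM a b : commutes a -> commutes b -> commutes (cLp_mul a b).
Proof. by move=> ha hb f; rewrite !M_mul ha hb. Qed.

Lemma commutes1 : commutes (zpow R 0).
Proof.
have M1 f : M_ (zpow R 0) f = f.
  apply: cLp_ext; near=> z; rewrite (near (reprM (zpow R 0) f) z)//.
  by rewrite (near (repr_zpow R 0) z)// mul1r.
by move=> f; rewrite !M1.
Unshelve. all: by end_near. Qed.

(** Closure under division makes step functions limits of explicit rational
functions, see [fcommutes_lt]. *)
Lemma commutes_inv a b : (forall f, M_ a (M_ b f) = f) -> commutes a -> commutes b.
Proof.
move=> ab ha f; have ba (g : L2) : M_ b (M_ a g) = g by rewrite M_comm ab.
by rewrite -[LHS]ba -ha ab.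
Qed.

Lemma commutes_cvg (g_ : nat -> Linf) (g : Linf) (D : R) :
  (forall n, commutes (g_ n)) ->
  (forall n, \forall z \ae m, normc (repr (g_ n) z) <= D) ->
  (\forall z \ae m, normc (repr (g_ n) z - repr g z) @[n --> \oo] --> (0 : R)) ->
  commutes g.
Proof.
move=> gc gD gg f; apply/eqP; rewrite -subr_eq0; apply/eqP/cLp_norm_eq0/eqP.
rewrite eq_le cLp_norm_ge0 andbT.
have h1 := bounded_cvg (Y f) gD gg; have h2 := bounded_cvg f gD gg.
have h3 : B * N (M_ (g_ n) f - M_ g f) + N (M_ (g_ n) (Y f) - M_ g (Y f))
    @[n --> \oo] --> (0 : R).
  by rewrite -[X in _ --> X]addr0 -{1}(mulr0 B); apply: cvgD => //; apply: cvgM => //; exact: cvg_cst.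
apply: (ler_cvg_to (cvg_cst _) h3); apply: nearW => n.
apply: (le_trans (normB_trans (M_ (g_ n) (Y f)) _ _)); apply: lerD => //.
by rewrite -gc -Y_B normBC; exact: Y_bounded.
Qed.

Definition bounded_mfun (g : circle R -> R) :=
  measurable_fun setT g /\ exists D : R, forall z, `|g z| <= D.

Definition rclass (g : circle R -> R) : Linf := toLp m (leey 1%E) (fun z => (g z)%:C%C).

Lemma repr_rclass g : bounded_mfun g -> \forall z \ae m, repr (rclass g) z = (g z)%:C%C.
Proof.
move=> [mg [D gD]]; apply: toLpK; apply: (@bounded_cLfun _ _ _ _ _ D).
  by split => //; exact: measurable_cst.
by apply: aeW => z; rewrite normc_real.
Qed.

(** Commutation is tested on real functions, for which pointwise limits, indicator
functions and the order are at hand; complex functions are recovered from their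
real and imaginary parts. *)
Definition fcommutes g := bounded_mfun g /\ commutes (rclass g).

Lemma fcommutes_ae g a : bounded_mfun g -> commutes a ->
  (\forall z \ae m, repr a z = (g z)%:C%C) -> fcommutes g.
Proof.
move=> bg ca ag; split => //; rewrite (_ : rclass g = a)//.
by apply: cLp_ext; apply: filterS2 ag (repr_rclass bg) => z -> ->.
Qed.

Lemma fcommutes_cst (r : R) : fcommutes (cst r).
Proof.
apply: (@fcommutes_ae _ (r%:C%C *: zpow R 0)).
- by split; [exact: measurable_cst|exists `|r|].
- exact/commutesZ/commutes1.
- by apply: filterS2 (reprZ r%:C%C (zpow R 0)) (repr_zpow R 0) => z -> ->; rewrite mulr1.
Qed.

Lemma fcommutesD u v : fcommutes u -> fcommutes v -> fcommutes (fun z => u z + v z).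
Proof.
move=> [bu cu] [bv cv]; apply: (@fcommutes_ae _ (rclass u + rclass v)).
- have [mu [D1 uD]] := bu; have [mv [D2 vD]] := bv.
  split; first exact: measurable_funD.
  by exists (D1 + D2) => z; rewrite (le_trans (ler_normD _ _))// lerD.
- exact: commutesD.
- near=> z; rewrite (near (reprD (rclass u) (rclass v)) z)// (near (repr_rclass bu) z)//.
  by rewrite (near (repr_rclass bv) z)// rmorphD.
Unshelve. all: by end_near. Qed.

Lemma fcommutesM u v : fcommutes u -> fcommutes v -> fcommutes (fun z => u z * v z).
Proof.
move=> [bu cu] [bv cv]; apply: (@fcommutes_ae _ (cLp_mul (rclass u) (rclass v))).
- have [mu [D1 uD]] := bu; have [mv [D2 vD]] := bv.
  split; first exact: measurable_funM.
  by exists (D1 * D2) => z; rewrite normrM ler_pM.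
- exact: commutesM.
- near=> z; rewrite (near (reprM (rclass u) (rclass v)) z)// (near (repr_rclass bu) z)//.
  by rewrite (near (repr_rclass bv) z)// rmorphM.
Unshelve. all: by end_near. Qed.

Lemma fcommutesX u n : fcommutes u -> fcommutes (fun z => u z ^+ n).
Proof.
move=> cu; elim: n => [|n ih]; first exact: fcommutes_cst 1.
by under eq_fun do rewrite exprS; exact: fcommutesM.
Qed.

Lemma fcommutesV u : (forall z, 1 <= u z) -> fcommutes u -> fcommutes (fun z => (u z)^-1).
Proof.
move=> u1 [bu cu].
have u0 z : 0 < u z by rewrite (lt_le_trans _ (u1 z)).
have bV : bounded_mfun (fun z => (u z)^-1).
  have [mu _] := bu; split.
    rewrite (_ : (fun z => _) = (@powR R ^~ (-1)) \o u).
      by apply: measurableT_comp => //; exact: measurable_powR.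
    by apply/funext => z /=; rewrite powR_inv1// ltW.
  by exists 1 => z; rewrite ger0_norm ?invr_ge0 ?invf_le1// ltW.
split => //; apply: (commutes_inv _ cu) => f.
apply: cLp_ext; near=> z.
rewrite (near (reprM (rclass u) (M_ (rclass (fun z => (u z)^-1)) f)) z)//.
rewrite (near (reprM (rclass (fun z => (u z)^-1)) f) z)//.
rewrite (near (repr_rclass bu) z)// (near (repr_rclass bV) z)// mulrA -realcM.
by rewrite divff ?mul1r// gt_eqF.
Unshelve. all: by end_near. Qed.

Lemma fcommutes_cvg (u_ : nat -> circle R -> R) u (D : R) :
  (forall n, fcommutes (u_ n)) -> (forall n z, `|u_ n z| <= D) ->
  (forall z, u_ n z @[n --> \oo] --> u z) -> fcommutes u.
Proof.
move=> cu uD uu.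
have bu : bounded_mfun u.
  split.
    by apply: (@measurable_fun_cvg _ _ _ setT u_) => [n|z _]; [have [[]] := cu n|exact: uu].
  exists D => z; have /cvg_norm nz := uu z.
  by apply: (ler_cvg_to nz (cvg_cst D)); exact: nearW.
split => //; apply: (@commutes_cvg (fun n => rclass (u_ n)) _ D).
- by move=> n; have [] := cu n.
- move=> n; have [bn _] := cu n.
  by apply: filterS (repr_rclass bn) => z ->; rewrite normc_real.
- have aeu : \forall z \ae m, forall n, repr (rclass (u_ n)) z = (u_ n z)%:C%C.
    by apply: ae_foralln => n; apply: repr_rclass; have [] := cu n.
  apply: filterS2 aeu (repr_rclass bu) => z zu ->.
  under eq_fun do rewrite zu -realcB normc_real.
  rewrite -(@normr0 R R) -[X in `|X|](subrr (u z)).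
  by apply: cvg_norm; apply: cvgB => //; exact: cvg_cst.
Qed.

(** An explicit limit of rational functions that is discontinuous at 1, from
which indicator functions are made. *)
Lemma cvg_inv_1DX (x : R) : 0 < x ->
  (1 + x ^+ n)^-1 @[n --> \oo] --> (if x < 1 then 1 else if x == 1 then 2^-1 else 0 : R).
Proof.
move=> x0; case: ltgtP => [x1|x1|->].
- have h : x ^+ n @[n --> \oo] --> (0 : R) by apply: cvg_expr; rewrite gtr0_norm.
  have h1 : 1 + x ^+ n @[n --> \oo] --> (1 : R).
    by rewrite -[X in _ --> X]addr0; apply: cvgD => //; exact: cvg_cst.
  by rewrite -[X in _ --> X]invr1; apply: cvgV => //; exact: oner_neq0.
- have h : x^-1 ^+ n @[n --> \oo] --> (0 : R).
    by apply: cvg_expr; rewrite gtr0_norm ?invr_gt0// invf_lt1.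
  apply: (squeeze_cvgr _ (cvg_cst 0) h); apply: nearW => n.
  have xn : 0 < x ^+ n by rewrite exprn_gt0.
  by rewrite invr_ge0 addr_ge0 ?(ltW xn)//= exprVn lef_pV2 ?posrE ?addr_gt0// lerDr.
- under eq_fun do rewrite expr1n.
  exact: cvg_cst.
Qed.

(** After an affine change of variable that makes u positive and moves the threshold
to 1, the limit l of 1 / (1 + u^n) takes the values 1, 1/2 and 0, and l (2 l - 1)
is the indicator function of l = 1. *)
Lemma fcommutes_lt u (s : R) : (forall z, `|u z| <= 1) -> fcommutes u ->
  fcommutes (fun z => (u z < s)%R%:R).
Proof.
move=> u1 cu.
have ur z : -1 <= u z by have := u1 z; rewrite ler_norml => /andP[].
have [s1|s1] := leP s (-1).
  rewrite (_ : (fun _ => _) = cst 0); first exact: fcommutes_cst.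
  by apply/funext => z /=; rewrite ltNge (le_trans s1 (ur z)).
have s0 : 0 < s + 2 by lra.
pose x z := (u z + 2) * (s + 2)^-1.
have x0 z : 0 < x z by rewrite /x divr_gt0//; have := ur z; lra.
have cx : fcommutes x.
  by apply: fcommutesM; [apply: fcommutesD => //|]; exact: fcommutes_cst.
pose l (y : R) : R := if y < 1 then 1 else if y == 1 then 2^-1 else 0.
have cl : fcommutes (l \o x).
  have D1 n z : 1 <= 1 + x z ^+ n by rewrite lerDl exprn_ge0// ltW.
  apply: (@fcommutes_cvg (fun n z => (1 + x z ^+ n)^-1) _ 1).
  - move=> n; apply: fcommutesV => //; apply: fcommutesD; first exact: fcommutes_cst.
    exact: fcommutesX.
  - move=> n z; rewrite ger0_norm ?invr_ge0 ?(le_trans _ (D1 n z))//.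
    by rewrite invf_le1 ?(lt_le_trans _ (D1 n z)).
  - by move=> z; exact: cvg_inv_1DX.
rewrite (_ : (fun _ => _) = (fun z => (l \o x) z * (2 * (l \o x) z + - 1))).
  apply: fcommutesM => //; apply: fcommutesD; last exact: fcommutes_cst.
  by apply: fcommutesM => //; exact: fcommutes_cst.
apply/funext => z; rewrite /= /l.
have -> : (u z < s) = (x z < 1) by rewrite /x ltr_pdivrMr// mul1r ltrD2r.
by case: ltgtP => _ /=; lra.
Qed.

Definition scommutes (A : set (circle R)) := fcommutes (\1_A : circle R -> R).

Lemma scommutesC A : scommutes A -> scommutes (~` A).
Proof.
move=> cA; rewrite /scommutes (_ : \1_(~` A) = (fun z => 1 + (-1) * (\1_A z : R))).
  apply: fcommutesD; first exact: fcommutes_cst.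
  by apply: fcommutesM => //; exact: fcommutes_cst.
apply/funext => z; rewrite !indicE in_setC.
by case: (z \in A) => /=; lra.
Qed.

Lemma scommutes_bigcup (A : nat -> set (circle R)) : (forall n, scommutes (A n)) ->
  scommutes (\bigcup_n A n).
Proof.
move=> cA.
have cU n : scommutes (\big[setU/set0]_(i < n) A i).
  elim: n => [|n ih].
    by rewrite big_ord0 /scommutes indic0; exact: fcommutes_cst.
  rewrite big_ord_recr/= -[X in scommutes X]setCK setCU; apply: scommutesC.
  rewrite /scommutes indicI; apply: fcommutesM; exact: scommutesC.
apply: (@fcommutes_cvg (fun n => \1_(\big[setU/set0]_(i < n) A i)) _ 1) => //.
  by move=> n z; rewrite indicE; case: (_ \in _); rewrite ?normr1 ?normr0.
move=> z; rewrite (indicE _ (\bigcup_n A n)).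
have [[n _ Az]|nA] := pselect ((\bigcup_n A n) z).
  rewrite mem_set; last by exists n.
  apply: cvg_near_cst; near=> k; rewrite indicE mem_set// -bigcup_mkord.
  by exists n => //=; near: k; exact: nbhs_infty_gt.
rewrite memNset//; apply: cvg_near_cst; apply: nearW => k.
rewrite indicE memNset// -bigcup_mkord => -[n _ Az].
by apply: nA; exists n.
Unshelve. all: by end_near. Qed.

(** Complements come from 1 - u, finite intersections from products, and countable
unions from bounded limits. *)
Lemma scommutes_sigma (T : Type) (phi : circle R -> T) :
  sigma_algebra setT [set A | scommutes (phi @^-1` A)].
Proof.
split.
- by rewrite /= preimage_set0 /scommutes indic0; exact: fcommutes_cst.
- by move=> A; rewrite /= setTD preimage_setC; exact: scommutesC.
- by move=> A cA; rewrite /= preimage_bigcup; exact: scommutes_bigcup.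
Qed.

Hypothesis Y_shift : commutes (zpow R 1).

Lemma commutes_zN1 : commutes (zpow R (-1)).
Proof. by apply: commutes_inv Y_shift => f; exact: M_zpowVK. Qed.

Lemma circle_bounded (z : circle R) : `|Re (z : C)| <= 1 /\ `|Im (z : C)| <= 1.
Proof. by rewrite -(normc_circle z) normRe normIm. Qed.

Lemma repr_zN1 : \forall z \ae m, repr (zpow R (-1)) z = conjc (z : C).
Proof. by apply: filterS (repr_zpow R (-1)) => z ->; rewrite conj_circle. Qed.

Lemma repr_z1 : \forall z \ae m, repr (zpow R 1) z = (z : C).
Proof. exact: repr_zpow. Qed.

Lemma fcommutes_Re : fcommutes (fun z : circle R => Re (z : C)).
Proof.
apply: (@fcommutes_ae _ ((2^-1)%:C%C *: (zpow R 1 + zpow R (-1)))).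
- split; first by have [] := cmeasurable_circle_val R.
  by exists 1 => z; have [] := circle_bounded z.
- by apply: commutesZ; apply: commutesD => //; exact: commutes_zN1.
- near=> z; rewrite (near (reprZ (2^-1)%:C%C (zpow R 1 + zpow R (-1))) z)//.
  rewrite (near (reprD (zpow R 1) (zpow R (-1))) z)//.
  rewrite (near repr_zN1 z)// (near repr_z1 z)//.
  apply: complex_ext; rewrite ?ReM ?ImM ReD ImD Re_conj Im_conj /=; lra.
Unshelve. all: by end_near. Qed.

Lemma fcommutes_Im : fcommutes (fun z : circle R => Im (z : C)).
Proof.
apply: (@fcommutes_ae _ (Complex 0 (- 2^-1) *: (zpow R 1 + (-1) *: zpow R (-1)))).
- split; first by have [] := cmeasurable_circle_val R.
  by exists 1 => z; have [] := circle_bounded z.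
- by apply: commutesZ; apply: commutesD => //; apply: commutesZ; exact: commutes_zN1.
- near=> z.
  rewrite (near (reprZ (Complex 0 (- 2^-1)) (zpow R 1 + (-1) *: zpow R (-1))) z)//.
  rewrite (near (reprD (zpow R 1) ((-1) *: zpow R (-1))) z)//.
  rewrite (near (reprZ (-1) (zpow R (-1))) z)//.
  rewrite (near repr_zN1 z)// (near repr_z1 z)// mulN1r.
  apply: complex_ext; rewrite ?ReM ?ImM ReD ImD ReN ImN Re_conj Im_conj /=; lra.
Unshelve. all: by end_near. Qed.

Lemma scommutes_real (u : circle R -> R) (A : set (measurableTypeR R)) :
  (forall z, `|u z| <= 1) -> fcommutes u -> measurable A -> scommutes (u @^-1` A).
Proof.
move=> u1 cu; rewrite -[measurable A]/((@ocitv R).-sigma.-measurable A).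
rewrite (RGenInftyO.measurableE R); move: A.
apply: smallest_sub; first exact: scommutes_sigma.
move=> _ [s ->] /=; rewrite /scommutes.
rewrite (_ : \1__ = (fun z => (u z < s)%R%:R)); first exact: fcommutes_lt.
apply/funext => z; rewrite indicE; congr (_%:R); congr nat_of_bool.
apply/idP/idP; first by move=> /set_mem; rewrite /= in_itv.
by move=> us; apply/mem_set; rewrite /= in_itv.
Qed.

Lemma scommutes_measurable (A : set (circle R)) : measurable A -> scommutes A.
Proof.
move=> [D mD <-]; rewrite setTI; move: D mD.
rewrite /measurable/=.
apply: smallest_sub; first exact: scommutes_sigma.
move=> _ [] [D mD <-]; rewrite /= setTI.
- apply: (@scommutes_real (fun z : circle R => Re (z : C))) => //.
    by move=> z; have [] := circle_bounded z.
  exact: fcommutes_Re.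
- apply: (@scommutes_real (fun z : circle R => Im (z : C))) => //.
    by move=> z; have [] := circle_bounded z.
  exact: fcommutes_Im.
Qed.

Import HBSimple HBNNSimple.

(** Nonnegative functions are increasing limits of simple functions, and a constant
makes a bounded function nonnegative. *)
Lemma fcommutes_bounded g : bounded_mfun g -> fcommutes g.
Proof.
move=> [mg [D gD]].
have gD' z : 0 <= g z + D by have := gD z; rewrite ler_norml => /andP[]; lra.
have mgD : measurable_fun setT (fun z => (g z + D)%:E).
  by apply/measurable_EFinP; apply: measurable_funD => //; exact: measurable_cst.
pose s_ := nnsfun_approx measurableT mgD.
have sle n z : s_ n z <= g z + D.
  by rewrite -lee_fin /s_ nnsfun_approxE; apply: le_approx => // x _; rewrite lee_fin.
have cs n : fcommutes (s_ n : circle R -> R).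
  have csum (r : seq R) : fcommutes (fun z : circle R =>
      \sum_(y <- r) y * \1_(s_ n @^-1` [set y]) z).
    elim: r => [|y r ih].
      by under eq_fun do rewrite big_nil; exact: fcommutes_cst.
    under eq_fun do rewrite big_cons; apply: fcommutesD => //.
    apply: fcommutesM; first exact: fcommutes_cst.
    by apply: scommutes_measurable; exact: measurable_sfunP.
  have := csum (finmap.enum_fset (fset_set (range (s_ n)))); congr fcommutes.
  by apply/funext => z; rewrite fimfunE fsbig_finite.
have cgD : fcommutes (fun z => g z + D).
  apply: (@fcommutes_cvg (fun n z => s_ n z) _ (D + D)) => //.
    move=> n z; rewrite ger0_norm//; apply: le_trans (sle n z) _.
    by rewrite lerD2r; have := gD z; rewrite ler_norml => /andP[].
  move=> z; have := cvg_nnsfun_approx measurableT mgD (fun x _ => _) (Logic.I : setT z).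
  move=> /(_ _) /fine_cvg; apply => x; rewrite lee_fin.
  exact: gD'.
rewrite (_ : g = (fun z => (g z + D) + cst (- D) z)).
  by apply: fcommutesD => //; exact: fcommutes_cst.
by apply/funext => z; rewrite /= addrK.
Qed.

End commutant.

(** * The commutant of the bilateral shift *)

Section commutant_of_shift.
Context (R : realType).
Local Notation m := (circle_measure R).
Local Notation L2 := (L2 R).
Local Notation Linf := (Linf R).
Local Notation C := R[i].
Local Open Scope quotient_scope.
Local Notation N := (@cLp_norm _ _ _ m _ (lee1n 2)).
Local Notation one := (toL2 (zpow R 0)).

Variable Y : L2 -> L2.
Hypothesis Y_linear : linear Y.
Variable B : R.
Hypothesis B_ge0 : 0 <= B.
Hypothesis Y_bounded : forall f, N (Y f) <= B * N f.
Hypothesis Y_shift : commutes Y (zpow R 1).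

(** On A = {|Y 1| > B} the operator gives |1_A Y 1| = |Y 1_A| <= B |1_A| in norm,
whereas pointwise |Y 1| > B on A; hence A is negligible. *)
Lemma commutant_symbol_bounded : \forall z \ae m, normc (repr (Y one) z) <= B.
Proof.
set h := Y one.
pose A := [set z | B < normc (repr h z)].
have mA : measurable A.
  have mn := cmeasurable_normc (repr_cmeasurable h).
  rewrite -[A]setTI (_ : setT `&` A = setT `&` (@normc R \o repr h) @^-1` `]B, +oo[).
    exact: mn.
  by congr (_ `&` _); apply/seteqP; split => z /=; rewrite in_itv/= andbT.
have bA : bounded_mfun (\1_A : circle R -> R).
  split; first exact: measurable_indic.
  by exists 1 => z; rewrite indicE; case: (_ \in _); rewrite ?normr1 ?normr0.
have [_ cA] := fcommutes_bounded Y_linear Y_bounded Y_shift bA.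
pose q := rclass (\1_A : circle R -> R).
have qh := repr_rclass bA.
pose d z := normc (repr (M_ q h) z) ^+ 2 - B ^+ 2 * normc (repr (M_ q one) z) ^+ 2.
have id : m.-integrable setT (EFin \o d).
  rewrite (_ : _ \o _ = (EFin \o (fun z => (normc (repr (M_ q h) z) ^+ 2)%R)) \-
      (EFin \o (fun z => (B ^+ 2 * normc (repr (M_ q one) z) ^+ 2)%R)))%E.
    apply: integrableB => //; first exact: cLfun2_integrable_sqr (repr_L2 _).
    by apply: integrable_scale; exact: cLfun2_integrable_sqr (repr_L2 _).
  by apply/funext => z; rewrite /= EFinB.
have dE : \forall z \ae m,
    d z = (\1_A z : R) ^+ 2 * (normc (repr h z) ^+ 2 - B ^+ 2).
  near=> z; rewrite /d (near (reprM q h) z)// (near (reprM q one) z)//.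
  rewrite (near qh z)// (near (repr_one R) z)// mulr1 normcM normc_real.
  by rewrite exprMn real_normK ?num_real//; ring.
have d0 : \forall z \ae m, 0 <= d z.
  apply: filterS dE => z ->; rewrite indicE; case: (boolP (z \in A)) => [/set_mem Az|_].
    by rewrite expr1n mul1r subr_ge0 ler_sqr ?nnegrE ?normc_ge0// ltW.
  by rewrite expr0n mul0r.
have intd : \int[m]_z d z <= 0.
  rewrite RintegralB//; last 2 first.
    exact: cLfun2_integrable_sqr (repr_L2 _).
    by apply: integrable_scale; exact: cLfun2_integrable_sqr (repr_L2 _).
  rewrite RintegralZl//; last exact: cLfun2_integrable_sqr (repr_L2 _).
  rewrite -!cLp_norm_sqr subr_le0 -exprMn ler_sqr ?nnegrE ?mulr_ge0 ?cLp_norm_ge0//.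
  by rewrite /h -cA.
have md : measurable_fun setT (EFin \o d) by have /integrableP[] := id.
have absd : (\int[m]_z `|(EFin \o d) z| = 0)%E.
  have absdE : (\int[m]_z `|(EFin \o d) z| = \int[m]_z (d z)%:E)%E.
    apply: ae_eq_integral => //; first exact: measurableT_comp.
    by apply: filterS d0 => z dz _; rewrite /= ger0_norm.
  apply/eqP; rewrite eq_le; apply/andP; split; last exact: integral_ge0.
  rewrite absdE -[leLHS]fineK ?lee_fin//.
  exact: (integrable_fin_num measurableT id).
have ae0 := (ae_eq_integral_abs m measurableT md).1 absd.
apply: filterS2 dE ae0 => z dz /(_ Logic.I) /= [] dz0.
rewrite leNgt; apply/negP => Az; move: dz; rewrite dz0 indicE mem_set//= expr1n mul1r.
move/esym/eqP; rewrite subr_eq0 => /eqP e.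
have : B ^+ 2 < normc (repr h z) ^+ 2 by rewrite ltr_sqr ?nnegrE ?normc_ge0.
by rewrite e ltxx.
Unshelve. all: by end_near. Qed.

Lemma commutes_bounded (b : circle R -> C) (D : R) : cmeasurable b ->
  (forall z, normc (b z) <= D) -> commutes Y (toLp m (leey 1%E) b).
Proof.
move=> mb bD; have [mr mi] := mb.
have br : bounded_mfun (fun z => Re (b z)).
  by split => //; exists D => z; exact: le_trans (normRe _) (bD z).
have bi : bounded_mfun (fun z => Im (b z)).
  by split => //; exists D => z; exact: le_trans (normIm _) (bD z).
have [_ cr] := fcommutes_bounded Y_linear Y_bounded Y_shift br.
have [_ ci] := fcommutes_bounded Y_linear Y_bounded Y_shift bi.
rewrite (_ : toLp _ _ b = rclass (fun z => Re (b z)) + 'i%C *: rclass (fun z => Im (b z))).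
  by apply: commutesD => //; exact: commutesZ.
have bL : b \in cLfun_pred m +oo%E.
  by apply: (@bounded_cLfun _ _ _ _ _ D) => //; exact: aeW.
apply: cLp_ext; near=> z; rewrite (near (toLpK (leey 1%E) bL) z)//.
rewrite (near (reprD (rclass (fun z => Re (b z)))
  ('i%C *: rclass (fun z => Im (b z)))) z)//.
rewrite (near (reprZ 'i%C (rclass (fun z => Im (b z)))) z)//.
by rewrite (near (repr_rclass br) z)// (near (repr_rclass bi) z)// -complexE.
Unshelve. all: by end_near. Qed.

(** The function w = 1 / (1 + |f|) is bounded and so is w f; hence
w Y f = Y (w f) = w f Y 1, and w vanishes nowhere. *)
Theorem commutant_of_shift : exists beta : Linf, forall f, Y f = M_ beta f.
Proof.
pose beta : Linf := toLp m (leey 1%E) (repr (Y one)).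
have bL : (repr (Y one) : circle R -> C) \in cLfun_pred m +oo%E.
  exact: bounded_cLfun (repr_cmeasurable _) commutant_symbol_bounded.
have Y1 : Y one = toL2 beta.
  apply: cLp_ext; apply: filterS2 (repr_toL2 beta) (toLpK (leey 1%E) bL) => z.
  by rewrite /beta => -> ->.
exists beta => f.
pose w z : C := ((1 + normc (repr f z))^-1)%:C%C.
have den z : 0 < 1 + normc (repr f z) by rewrite ltr_wpDr// normc_ge0.
have mw : cmeasurable w.
  split; last exact: measurable_cst.
  rewrite (_ : _ \o _ = (@powR R ^~ (-1)) \o (fun z => 1 + normc (repr f z))).
    apply: measurableT_comp; first exact: measurable_powR.
    apply: measurable_funD; first exact: measurable_cst.
    exact: cmeasurable_normc (repr_cmeasurable f).
  by apply/funext => z /=; rewrite powR_inv1// ltW.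
have wnorm z : normc (w z) = (1 + normc (repr f z))^-1.
  by rewrite normc_real ger0_norm// invr_ge0 ltW.
have w1 z : normc (w z) <= 1.
  by rewrite wnorm invf_le1// lerDl normc_ge0.
have mwf : cmeasurable (fun z => w z * repr f z).
  exact: cmeasurableM mw (repr_cmeasurable f).
have wf1 z : normc (w z * repr f z) <= 1.
  by rewrite normcM wnorm mulrC ler_pdivrMr// mul1r lerDr.
have wL : w \in cLfun_pred m +oo%E by apply: bounded_cLfun mw _; exact: aeW w1.
have wfL : (fun z => w z * repr f z) \in cLfun_pred m +oo%E.
  by apply: bounded_cLfun mwf _; exact: aeW wf1.
set W := toLp m (leey 1%E) w; set G := toLp m (leey 1%E) (fun z => w z * repr f z).
have WfE : M_ W f = M_ G one.
  apply: cLp_ext; near=> z; rewrite (near (reprM W f) z)// (near (reprM G one) z)//.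
  rewrite (near (repr_one R) z)// mulr1 (near (toLpK (leey 1%E) wL) z)//.
  by rewrite (near (toLpK (leey 1%E) wfL) z).
have WY : M_ W (Y f) = M_ W (M_ beta f).
  rewrite -(commutes_bounded mw w1) WfE (commutes_bounded mwf wf1) Y1 -M_toL2.
  by rewrite M_comm -WfE M_comm.
apply: cLp_ext; near=> z.
have wz : w z != 0.
  by apply/eqP => w0; have := wnorm z; rewrite w0 normc0 => /esym/eqP; rewrite invr_eq0 gt_eqF.
apply: (mulfI wz); rewrite -(near (toLpK (leey 1%E) wL) z)//.
rewrite -(near (reprM W (Y f)) z)// -(near (reprM W (M_ beta f)) z)//.
exact: (congr1 (fun u : L2 => repr u z) WY).
Unshelve. all: by end_near. Qed.

End commutant_of_shift.

(** * The characterization *)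

Theorem theorem3p7 (R : realType) (F : R[i] -> R[i]) (theta a : Linf R)
    (X : {linear L2 R -> L2 R}) :
  inner_function F theta -> ~ constant_on (@unit_disk R) F ->
  bounded_operator X ->
  let P : L2 R -> L2 R := orth_proj (model_space theta) in
  let identity : Prop :=
    commutator X (M_ (zpow R 1)) =
    rank_one (toL2 a) (toL2 (zpow R (-1))) \-
    rank_one (M_ a (toL2 theta)) (M_ theta (toL2 (zpow R (-1)))) in
  ((exists beta : Linf R, X = M_ beta \+ (M_ a \o P) :> (L2 R -> L2 R)) <->
   identity) /\
  ((exists phi psi : Linf R, phi - psi = a /\
      X = (M_ phi \o P) \+ (M_ psi \o (idfun \- P)) :> (L2 R -> L2 R)) <->
   identity).
Proof.
move=> innF _ [B0 XB0] P identity.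
have th1 : unimodular theta by have [] := innF.
have thH := inner_function_hardy_multiplier innF.
have PE : P = model_proj theta by apply/funext => f; exact: orth_proj_model.
have PD f g : P (f - g) = P f - P g.
  by rewrite addrC -scaleN1r PE model_projZD scaleN1r addrC.
have key f : M_ a (P (M_ (zpow R 1) f)) - M_ (zpow R 1) (M_ a (P f)) =
    (rank_one (toL2 a) (toL2 (zpow R (-1))) \-
     rank_one (M_ a (toL2 theta)) (M_ theta (toL2 (zpow R (-1))))) f.
  by rewrite M_comm -M_B PE model_proj_shift M_B !M_Z M_toL2.
have first_iff : (exists beta : Linf R,
    X = M_ beta \+ (M_ a \o P) :> (L2 R -> L2 R)) <-> identity.
  split=> [[beta XE]|id].
    apply/funext => f; rewrite -key /commutator /= XE /=.
    by rewrite M_D (M_comm beta) opprD addrACA subrr add0r.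
  pose Y : L2 R -> L2 R := X \- (M_ a \o P).
  have Ylin : linear Y.
    move=> c f g; rewrite /Y /= PE linearP model_projZD M_D M_Z.
    by rewrite opprD addrACA scalerBr.
  have [B1 B1_ge0 PB] := model_proj_bounded theta.
  have [B2 B2_ge0 aB] := M_bounded a.
  pose B := `|B0| + B2 * B1.
  have B_ge0 : 0 <= B by rewrite addr_ge0 ?mulr_ge0.
  have YB f : cLp_norm (Y f) <= B * cLp_norm f.
    rewrite (le_trans (normD _ _))// normN mulrDl lerD//.
      by rewrite (le_trans (XB0 f))// ler_wpM2r ?cLp_norm_ge0 ?ler_norm.
    by rewrite (le_trans (aB _))// -mulrA ler_wpM2l// PE.
  have Yshift : commutes Y (zpow R 1).
    move=> f; rewrite /Y /= M_B.
    have := congr1 (fun T => T f) id; rewrite /commutator -key /= => /eqP.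
    by rewrite subr_eq => /eqP ->; rewrite addrC -!addrA addKr addrC.
  have [beta Ybeta] := commutant_of_shift Ylin B_ge0 YB Yshift.
  by exists beta; apply/funext => f; rewrite /= -Ybeta /Y /= subrK.
split=> //; apply: iff_trans first_iff; split=> [[phi [psi [<- XE]]]|[beta XE]].
  exists psi; rewrite XE; apply/funext => f /=.
  by rewrite M_B M_addl M_Nl addrCA.
exists (a + beta), beta; split; first by rewrite addrK.
rewrite XE; apply/funext => f /=.
by rewrite M_addl M_B -addrA (addrC (M_ beta (P f))) subrK addrC.
Qed.
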